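(* Let $(\mathfrak k,[\cdot,\cdot]_{\mathfrak k})$ be a semisimple real Lie algebra with Killing form $K$, and let $\mathrm{string}(\mathfrak k)$ be the corresponding string Lie $2$-algebra, i.e. $\mathfrak g_0=\mathfrak k$, $\mathfrak g_{-1}=\mathbb R$, $d=0$, $[x,y]=[x,y]_{\mathfrak k}$, $[x,r]=0$, $l_3(x,y,z)=K([x,y]_{\mathfrak k},z)$ for $x,y,z\in\mathfrak k$, $r\in\mathbb R$. Then $\mathrm{Der}^0(\mathrm{string}(\mathfrak k))$ is isomorphic, as a Lie algebra, to the semidirect product Lie algebra $\mathfrak k\ltimes_{\mathrm{ad}^*}\mathfrak k^*$. Furthermore, $\mathrm{Der}^{-1}(\mathrm{string}(\mathfrak k))=\mathfrak k^*$, which is abelian, and the differential $\bar d:\mathrm{Der}^{-1}(\mathrm{string}(\mathfrak k))\to\mathrm{Der}^{0}(\mathrm{string}(\mathfrak k))$ is given by $\bar d(\Theta)=(0,0,-\mathfrak D\Theta)$, where $\mathfrak D$ is the (Chevalley–Eilenberg) coboundary operator on $\mathfrak k$ with coefficients in the trivial representation $\mathbb R$.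
   Context: Semisimple Lie algebras are finite-dimensional. For a Lie $2$-algebra $\mathfrak g=(\mathfrak g_0\oplus\mathfrak g_{-1},d,[\cdot,\cdot],l_3)$ (a $2$-term $L_\infty$-algebra with differential $d:\mathfrak g_{-1}\to\mathfrak g_0$, bracket $[\cdot,\cdot]$ and $l_3:\wedge^3\mathfrak g_0\to\mathfrak g_{-1}$), the derivation Lie $2$-algebra $\mathrm{Der}(\mathfrak g)$ is defined as follows. $\mathrm{Der}^0(\mathfrak g)$ is the set of triples $(X_0,X_1,l_X)$ with $X_0\in\mathrm{End}(\mathfrak g_0)$, $X_1\in\mathrm{End}(\mathfrak g_{-1})$, $X_0\circ d=d\circ X_1$, and $l_X:\wedge^2\mathfrak g_0\to\mathfrak g_{-1}$ linear such that for all $x,y,z\in\mathfrak g_0$, $a\in\mathfrak g_{-1}$: $dl_X(x,y)=X_0[x,y]-[X_0x,y]-[x,X_0y]$; $l_X(x,da)=X_1[x,a]-[X_0x,a]-[x,X_1a]$; $X_1l_3(x,y,z)=\big(l_X(x,[y,z])+[x,l_X(y,z)]+l_3(X_0x,y,z)\big)+$ cyclic permutations of $(x,y,z)$. Its Lie bracket is $\{(X_0,X_1,l_X),(Y_0,Y_1,l_Y)\}=([X_0,Y_0],[X_1,Y_1],L_Xl_Y-L_Yl_X)$ with commutators and $L_X\omega(x,y)=X_1\omega(x,y)-\omega(X_0x,y)-\omega(x,X_0y)$. $\mathrm{Der}^{-1}(\mathfrak g)=\mathrm{Hom}(\mathfrak g_0,\mathfrak g_{-1})$, with Lie bracket $\{\Theta,\Theta'\}=\Theta\circ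 d\circ\Theta'-\Theta'\circ d\circ\Theta$, and $\bar d(\Theta)=(d\circ\Theta,\Theta\circ d,l_{\delta(\Theta)})$ with $l_{\delta(\Theta)}(x,y)=\Theta[x,y]-[x,\Theta y]-[\Theta x,y]$. The bracket of $\mathfrak k\ltimes_{\mathrm{ad}^*}\mathfrak k^*$ is $[(x,\xi),(y,\eta)]=([x,y]_{\mathfrak k},\mathrm{ad}^*_x\eta-\mathrm{ad}^*_y\xi)$, where $(\mathrm{ad}^*_x\xi)(y)=-\xi([x,y]_{\mathfrak k})$; and $(\mathfrak D\Theta)(x,y)=-\Theta([x,y]_{\mathfrak k})$ for $\Theta\in\mathfrak k^*$.
   Formalization: The isomorphism of Der^0(string(k)) with the semidirect product is stated for nonzero k: for k = 0 (which has zero radical) Der^0 is End(R), of dimension 1, while the semidirect product is 0; the other claims also cover k = 0. *)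

(* Defs.v *)
From HB Require Import structures.
From mathcomp Require Import all_boot all_order all_algebra.
From mathcomp Require Import boolp reals.

Set Implicit Arguments.
Unset Strict Implicit.
Unset Printing Implicit Defensive.

Import GRing.Theory passmx.
Local Open Scope ring_scope.

(** Bilinear and trilinear maps are elements of iterated ['Hom] spaces;
    [linfun f] is only meaningful when [f] is linear, hence the side
    conditions in [bilinE] and [trilinE]. *)

Definition bilin (F : fieldType) (U V W : vectType F) (f : U -> V -> W) :
  'Hom(U, 'Hom(V, W)) := linfun (fun x => linfun (f x)).

Definition trilin (F : fieldType) (U V W T : vectType F)
    (f : U -> V -> W -> T) : 'Hom(U, 'Hom(V, 'Hom(W, T))) :=
  linfun (fun x => bilin (f x)).

Lemma linfun_lin (F : fieldType) (U V : vectType F) (f : U -> V) :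
  linear f -> linfun f =1 f.
Proof.
move=> lf x.
pose A := GRing.isLinear.Build _ _ _ _ f lf.
pose f' : {linear U -> V} := HB.pack f A.
exact: (lfunE f').
Qed.

Lemma bilinE (F : fieldType) (U V W : vectType F) (f : U -> V -> W) :
    (forall x, linear (f x)) -> (forall y, linear (f^~ y)) ->
  forall x y, bilin f x y = f x y.
Proof.
move=> lr ll x y; rewrite linfun_lin ?linfun_lin // => a u v.
apply/lfunP=> z; rewrite lfunE /= lfunE /=.
by rewrite !linfun_lin // ll.
Qed.

Lemma trilinE (F : fieldType) (U V W T : vectType F) (f : U -> V -> W -> T) :
    (forall x y, linear (f x y)) -> (forall x z, linear (f x ^~ z)) ->
    (forall y z, linear (fun x => f x y z)) ->
  forall x y z, trilin f x y z = f x y z.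
Proof.
move=> l1 l2 l3 x y z; rewrite linfun_lin ?bilinE // => a u v.
apply/lfunP=> y'; apply/lfunP=> z'.
by rewrite !lfunE /= !lfunE /= !bilinE // l3.
Qed.

(** Decision procedure for equalities in abelian groups. *)
Inductive zexp := ZAtom of nat | ZAdd of zexp & zexp | ZOpp of zexp | ZNil.

Fixpoint zeval (V : zmodType) (l : seq V) (e : zexp) : V :=
  match e with
  | ZAtom i => nth 0 l i
  | ZAdd e1 e2 => zeval l e1 + zeval l e2
  | ZOpp e => - zeval l e
  | ZNil => 0
  end.

Fixpoint zcoef (e : zexp) (i : nat) : int :=
  match e with
  | ZAtom j => (i == j)%:Z
  | ZAdd e1 e2 => zcoef e1 i + zcoef e2 i
  | ZOpp e => - zcoef e i
  | ZNil => 0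
  end.

Lemma zeval_sum (V : zmodType) (l : seq V) e :
  zeval l e = \sum_(i < size l) nth 0 l i *~ zcoef e i.
Proof.
elim: e => [j|e1 IH1 e2 IH2|e IH|] /=.
- have [lt|ge] := ltnP j (size l); last first.
    rewrite nth_default // big1 // => i _.
    by rewrite (ltn_eqF (leq_trans (ltn_ord i) ge)).
  rewrite (bigD1 (Ordinal lt)) //= eqxx big1 ?addr0 // => i ne.
  by rewrite -val_eqE in ne; rewrite (negPf ne).
- by rewrite IH1 IH2 -big_split; apply: eq_bigr => i _; rewrite mulrzDr.
- by rewrite IH -sumrN; apply: eq_bigr => i _; rewrite mulrNz.
- by rewrite big1 // => i _; rewrite mulr0z.
Qed.

Lemma zmodP (V : zmodType) (l : seq V) e1 e2 :
  all (fun i => zcoef e1 i == zcoef e2 i) (iota 0 (size l)) ->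
  zeval l e1 = zeval l e2.
Proof.
move=> /allP h; rewrite !zeval_sum; apply: eq_bigr => i _; congr (_ *~ _).
by apply/eqP; apply: h; rewrite mem_iota ltn_ord.
Qed.

Ltac zatoms l t :=
  lazymatch t with
  | (?a + ?b)%R => let l := zatoms l a in zatoms l b
  | (- ?a)%R => zatoms l a
  | 0%R => l
  | _ => lazymatch l with context [t :: _] => l | _ => constr:(t :: l) end
  end.

Ltac zindex l t :=
  lazymatch l with
  | t :: _ => constr:(0%N)
  | _ :: ?l' => let n := zindex l' t in constr:(n.+1)
  end.

Ltac zreify l t :=
  lazymatch t with
  | (?a + ?b)%R =>
      let a := zreify l a in let b := zreify l b in constr:(ZAdd a b)
  | (- ?a)%R => let a := zreify l a in constr:(ZOpp a)
  | 0%R => constr:(ZNil)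
  | _ => let n := zindex l t in constr:(ZAtom n)
  end.

Ltac zmod := cbv beta;
  lazymatch goal with |- @eq ?T ?a ?b =>
    let l := zatoms (@nil T) a in let l := zatoms l b in
    let e1 := zreify l a in let e2 := zreify l b in
    refine (@zmodP _ l e1 e2 _); vm_compute; reflexivity
  end.

Section HomSimp.
Variables (F : fieldType) (U V : vectType F) (f : 'Hom(U, V)).

Let homD u v : f (u + v) = f u + f v. Proof. exact: linearD. Qed.
Let homN u : f (- u) = - f u. Proof. exact: linearN. Qed.
Let hom0 : f 0 = 0. Proof. exact: linear0. Qed.
Let homZ a u : f (a *: u) = a *: f u. Proof. exact: linearZ. Qed.

Definition hom_simp := (homD, homN, hom0, homZ).

End HomSimp.

Definition lfun_simp := (add_lfunE, opp_lfunE, scale_lfunE, zero_lfunE).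

HB.mixin Record isLieAlgebra (F : fieldType) V of GRing.Lmodule F V := {
  lie : V -> V -> V;
  lie_linear_l : forall y, linear (lie^~ y);
  lie_linear_r : forall x, linear (lie x);
  liexx : forall x, lie x x = 0;
  lie_jacobi : forall x y z,
    lie x (lie y z) + lie y (lie z x) + lie z (lie x y) = 0
}.

#[short(type="lieAlgType")]
HB.structure Definition LieAlgebra (F : fieldType) :=
  {V of GRing.Lmodule F V & isLieAlgebra F V}.

#[short(type="finLieAlgType")]
HB.structure Definition FinLieAlgebra (F : fieldType) :=
  {V of Vector F V & isLieAlgebra F V}.

Definition lie_isomorphic (F : fieldType) (L M : lieAlgType F) : Prop :=
  exists2 f : {linear L -> M}, bijective f & {morph f : x y / lie x y}.

Definition lie_abelian (F : fieldType) (L : lieAlgType F) : Prop :=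
  forall x y : L, lie x y = 0.

Section LieTheory.
Variables (F : fieldType) (L : lieAlgType F).
Implicit Types x y z : L.

Lemma lieDl x y z : lie (x + y) z = lie x z + lie y z.
Proof. by have := lie_linear_l z 1 x y; rewrite /= !scale1r. Qed.
Lemma lieDr x y z : lie z (x + y) = lie z x + lie z y.
Proof. by have := lie_linear_r z 1 x y; rewrite /= !scale1r. Qed.
Lemma lie0l x : lie 0 x = 0.
Proof. by apply: (addrI (lie 0 x)); rewrite -lieDl !addr0. Qed.
Lemma lie0r x : lie x 0 = 0.
Proof. by apply: (addrI (lie x 0)); rewrite -lieDr !addr0. Qed.
Lemma lieZl a x z : lie (a *: x) z = a *: lie x z.
Proof. by have := lie_linear_l z a x 0; rewrite /= !addr0 lie0l addr0. Qed.
Lemma lieZr a x z : lie z (a *: x) = a *: lie z x.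
Proof. by have := lie_linear_r z a x 0; rewrite /= !addr0 lie0r addr0. Qed.
Lemma lieC x y : lie x y = - lie y x.
Proof.
have := liexx (x + y); rewrite lieDl !lieDr !liexx add0r addr0.
by move/eqP; rewrite addr_eq0 => /eqP.
Qed.
Lemma lieNl x y : lie (- x) y = - lie x y.
Proof. by rewrite -scaleN1r lieZl scaleN1r. Qed.
Lemma lieNr x y : lie x (- y) = - lie x y.
Proof. by rewrite -scaleN1r lieZr scaleN1r. Qed.

End LieTheory.

Section FinLie.
Variables (F : fieldType) (k : finLieAlgType F).
Implicit Types (x y z : k) (I J : {vspace k}).

Definition is_ideal I : Prop := forall x y, y \in I -> lie x y \in I.

(** The span of all brackets [lie x y] with [x] in [I] and [y] in [J];
    by bilinearity basis vectors suffice, see [lie_in_prod] and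
    [lie_prod_min]. *)
Definition lie_prod I J : {vspace k} :=
  <<[seq lie x y | x <- vbasis I, y <- vbasis J]>>%VS.

Definition lie_solvable I : Prop :=
  exists n, iter n (fun J => lie_prod J J) I = 0%VS.

(** The radical, i.e. the greatest solvable ideal, vanishes.  The zero
    Lie algebra satisfies this definition. *)
Definition semisimple : Prop :=
  forall I, is_ideal I -> lie_solvable I -> I = 0%VS.

Definition ad : k -> 'End(k) := fun x => linfun (lie x).

(** [mxof e e f] is the matrix of [f] in the basis [e]. *)
Definition killing x y : F :=
  let e := vbasis {:k} in \tr (mxof e e (ad x \o ad y)%VF).

Definition dual : vectType F := 'Hom(k, F^o).

Definition coad x (xi : dual) : dual := linfun (fun y => - xi (lie x y)).

(** The Chevalley-Eilenberg coboundary of 1-cochains with trivial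
    coefficients. *)
Definition ceD (xi : dual) : 'Hom(k, 'Hom(k, F^o)) :=
  bilin (fun x y => - xi (lie x y)).

Lemma adE x y : ad x y = lie x y.
Proof. by rewrite /ad linfun_lin //; apply: lie_linear_r. Qed.

Lemma coad_lin x (xi : dual) : linear (fun y => - xi (lie x y) : F^o).
Proof.
by move=> a u v; rewrite lieDr lieZr linearD linearZ opprD scalerN.
Qed.

Lemma coadE x (xi : dual) y : coad x xi y = - xi (lie x y).
Proof. by rewrite /coad linfun_lin //; apply: coad_lin. Qed.

Lemma ceDE (xi : dual) x y : ceD xi x y = - xi (lie x y).
Proof.
apply: bilinE => [|z]; first exact: (fun x => coad_lin x xi).
by move=> a u v; rewrite lieDl lieZl linearD linearZ opprD scalerN.
Qed.

Lemma lie_in_prod I J x y : x \in I -> y \in J -> lie x y \in lie_prod I J.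
Proof.
move=> xI yJ; rewrite (coord_vbasis xI) (coord_vbasis yJ).
rewrite -adE linear_sum memv_suml // => j _; rewrite linearZ memvZ //= adE.
rewrite lieC memvN -adE linear_sum memv_suml // => i _.
rewrite linearZ memvZ //= adE lieC memvN memv_span //.
by apply/allpairsP; exists ((vbasis I)`_i, (vbasis J)`_j);
   rewrite /= !mem_nth ?size_tuple.
Qed.

Lemma lie_prod_min I J (M : {vspace k}) :
  (forall x y, x \in I -> y \in J -> lie x y \in M) -> (lie_prod I J <= M)%VS.
Proof.
move=> h; apply/span_subvP => _ /allpairsP[[x y] [/= xI yJ ->]].
by apply: h; apply: vbasis_mem.
Qed.

Local Notation mx := (mxof (vbasis {:k}) (vbasis {:k})).

Lemma killingE x y : killing x y = \tr (mx (ad y) *m mx (ad x)).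
Proof. by rewrite /killing (mxof_comp _ _ (vbasisP fullv)). Qed.

Lemma killingC x y : killing x y = killing y x.
Proof. by rewrite !killingE mxtrace_mulC. Qed.

Lemma adD x y : ad (x + y) = ad x + ad y.
Proof. by apply/lfunP=> z; rewrite add_lfunE !adE lieDl. Qed.

Lemma adZ a x : ad (a *: x) = a *: ad x.
Proof. by apply/lfunP=> z; rewrite scale_lfunE !adE lieZl. Qed.

Lemma killing_linear_l y : linear (killing^~ y : k -> F^o).
Proof.
move=> a u v; rewrite !killingE adD adZ linearD linearZ mulmxDr -scalemxAr.
by rewrite linearD linearZ.
Qed.

Lemma killing_linear_r x : linear (killing x : k -> F^o).
Proof.
by move=> a u v; rewrite ![killing x _]killingC killing_linear_l.
Qed.

Lemma ad_lie x y : ad (lie x y) = (ad x \o ad y)%VF - (ad y \o ad x)%VF.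
Proof.
apply/lfunP=> z; rewrite add_lfunE opp_lfunE !comp_lfunE !adE.
have := lie_jacobi x y z; rewrite [lie z (lie x y)]lieC [lie z x]lieC lieNr.
by move/eqP; rewrite subr_eq0 => /eqP.
Qed.

Lemma killing_inv x y z : killing (lie x y) z = killing x (lie y z).
Proof.
have mxB (f h : 'End(k)) : mx (f - h) = mx f - mx h by rewrite linearB.
have trB n (A B : 'M[F]_n) : \tr (A - B) = \tr A - \tr B by rewrite linearB.
rewrite !killingE !ad_lie !mxB !(mxof_comp _ _ (vbasisP fullv)).
rewrite mulmxBr mulmxBl !trB; congr (_ - _); first by rewrite mulmxA.
by rewrite mulmxA mxtrace_mulC mulmxA.
Qed.

End FinLie.

(** Two-term L-infinity algebras.  The degree [0 x -1] bracket is stored as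
    [lie2_act x a = [x, a]]; then [[a, x] = - [x, a]] and the bracket of two
    elements of degree -1 is zero. *)
Record lie2Alg (F : fieldType) := Lie2Alg {
  lie2_0 : vectType F;
  lie2_1 : vectType F;
  lie2_d : 'Hom(lie2_1, lie2_0);
  lie2_br : 'Hom(lie2_0, 'End(lie2_0));
  lie2_act : 'Hom(lie2_0, 'End(lie2_1));
  lie2_l3 : 'Hom(lie2_0, 'Hom(lie2_0, 'Hom(lie2_0, lie2_1)));
  lie2_brxx : forall x, lie2_br x x = 0;
  lie2_l3xxy : forall x y, lie2_l3 x x y = 0;
  lie2_l3xyy : forall x y, lie2_l3 x y y = 0;
  lie2_d_act : forall x a, lie2_d (lie2_act x a) = lie2_br x (lie2_d a);
  (* [da, b] = [a, db] *)
  lie2_act_d : forall a b,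
    lie2_act (lie2_d a) b = - lie2_act (lie2_d b) a;
  lie2_jac0 : forall x y z,
    lie2_d (lie2_l3 x y z) =
      lie2_br x (lie2_br y z) + lie2_br y (lie2_br z x)
      + lie2_br z (lie2_br x y);
  (* l3(x, y, da) = [x, [y, a]] + [y, [a, x]] + [a, [x, y]] *)
  lie2_jac1 : forall x y a,
    lie2_l3 x y (lie2_d a) =
      lie2_act x (lie2_act y a) - lie2_act y (lie2_act x a)
      - lie2_act (lie2_br x y) a;
  lie2_l3_closed : forall x y z t,
    lie2_act x (lie2_l3 y z t) - lie2_act y (lie2_l3 x z t)
    + lie2_act z (lie2_l3 x y t) - lie2_act t (lie2_l3 x y z) =
      lie2_l3 (lie2_br x y) z t - lie2_l3 (lie2_br x z) y t
      + lie2_l3 (lie2_br x t) y z + lie2_l3 (lie2_br y z) x t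
      - lie2_l3 (lie2_br y t) x z + lie2_l3 (lie2_br z t) x y
}.

Arguments lie2_d {F l}.
Arguments lie2_br {F l}.
Arguments lie2_act {F l}.
Arguments lie2_l3 {F l}.

(** The identities behind the closure properties of derivations, stated for
    plain additive functions. *)
Lemma commutator_jacobi (V : zmodType) (f h k : V -> V) :
    {morph f : x y / x + y} -> {morph h : x y / x + y} ->
    {morph k : x y / x + y} -> {morph f : x / - x} -> {morph h : x / - x} ->
    {morph k : x / - x} ->
  forall x, f (h (k x) - k (h x)) - (h (k (f x)) - k (h (f x)))
    + (h (k (f x) - f (k x)) - (k (f (h x)) - f (k (h x))))
    + (k (f (h x) - h (f x)) - (f (h (k x)) - h (f (k x)))) = 0.
Proof.
by move=> fD hD kD fN hN kN x; rewrite !(fD, hD, kD, fN, hN, kN); zmod.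
Qed.

Section JacobiIdentity.
Variables (U V : zmodType) (X0 Y0 Z0 : U -> U) (X1 Y1 Z1 : V -> V).
Variables (l m n : U -> U -> V).

Let L (A0 : U -> U) (A1 : V -> V) (w : U -> U -> V) x y :=
  A1 (w x y) - w (A0 x) y - w x (A0 y).
Let com (W : zmodType) (f g : W -> W) x := f (g x) - g (f x).
Let br (A0 B0 : U -> U) (A1 B1 : V -> V) (w v : U -> U -> V) x y :=
  L A0 A1 v x y - L B0 B1 w x y.

Hypothesis XD : {morph X1 : x y / x + y}.
Hypothesis YD : {morph Y1 : x y / x + y}.
Hypothesis ZD : {morph Z1 : x y / x + y}.
Hypothesis XN : {morph X1 : x / - x}.
Hypothesis YN : {morph Y1 : x / - x}.
Hypothesis ZN : {morph Z1 : x / - x}.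
Hypothesis lD : forall x, {morph l x : y z / y + z}.
Hypothesis mD : forall x, {morph m x : y z / y + z}.
Hypothesis nD : forall x, {morph n x : y z / y + z}.
Hypothesis lN : forall x, {morph l x : y / - y}.
Hypothesis mN : forall x, {morph m x : y / - y}.
Hypothesis nN : forall x, {morph n x : y / - y}.
Hypothesis lDl : forall x, {morph l^~ x : y z / y + z}.
Hypothesis mDl : forall x, {morph m^~ x : y z / y + z}.
Hypothesis nDl : forall x, {morph n^~ x : y z / y + z}.
Hypothesis lNl : forall x, {morph l^~ x : y / - y}.
Hypothesis mNl : forall x, {morph m^~ x : y / - y}.
Hypothesis nNl : forall x, {morph n^~ x : y / - y}.

Lemma bracket_jacobi x y :
  br X0 (com Y0 Z0) X1 (com Y1 Z1) l (br Y0 Z0 Y1 Z1 m n) x y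
  + br Y0 (com Z0 X0) Y1 (com Z1 X1) m (br Z0 X0 Z1 X1 n l) x y
  + br Z0 (com X0 Y0) Z1 (com X1 Y1) n (br X0 Y0 X1 Y1 l m) x y = 0.
Proof.
rewrite /br /L /com.
rewrite !(XD, YD, ZD, XN, YN, ZN, lD, mD, nD, lN, mN, nN).
rewrite !(lDl, mDl, nDl, lNl, mNl, nNl); zmod.
Qed.

End JacobiIdentity.

Section DerivationIdentities.
Variables (U V : zmodType) (d : V -> U) (br : U -> U -> U) (act : U -> V -> V).
Variables (l3 : U -> U -> U -> V).
Variables (X0 Y0 : U -> U) (X1 Y1 : V -> V) (l m : U -> U -> V).
Variable T : U -> V.

Let is_l3 (X0 : U -> U) (X1 : V -> V) (l : U -> U -> V) :=
  forall x y z, X1 (l3 x y z) =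
    (l x (br y z) + act x (l y z) + l3 (X0 x) y z)
    + (l y (br z x) + act y (l z x) + l3 (X0 y) z x)
    + (l z (br x y) + act z (l x y) + l3 (X0 z) x y).

Hypothesis dD : {morph d : a b / a + b}.
Hypothesis dN : {morph d : a / - a}.
Hypothesis brDl : forall z, {morph br^~ z : x y / x + y}.
Hypothesis brDr : forall z, {morph br z : x y / x + y}.
Hypothesis brNl : forall z, {morph br^~ z : x / - x}.
Hypothesis brNr : forall z, {morph br z : x / - x}.
Hypothesis actDl : forall a, {morph act^~ a : x y / x + y}.
Hypothesis actNl : forall a, {morph act^~ a : x / - x}.
Hypothesis actD : forall x, {morph act x : a b / a + b}.
Hypothesis actN : forall x, {morph act x : a / - a}.
Hypothesis l3D : forall y z, {morph (fun x => l3 x y z) : x y / x + y}.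
Hypothesis l3N : forall y z, {morph (fun x => l3 x y z) : x / - x}.
Hypothesis l3C12 : forall x y z, l3 x y z = - l3 y x z.
Hypothesis l3C23 : forall x y z, l3 x y z = - l3 x z y.

Section Bracket.
Hypothesis X0D : {morph X0 : x y / x + y}.
Hypothesis Y0D : {morph Y0 : x y / x + y}.
Hypothesis X0N : {morph X0 : x / - x}.
Hypothesis Y0N : {morph Y0 : x / - x}.
Hypothesis X1D : {morph X1 : x y / x + y}.
Hypothesis Y1D : {morph Y1 : x y / x + y}.
Hypothesis X0d : forall a, X0 (d a) = d (X1 a).
Hypothesis Y0d : forall a, Y0 (d a) = d (Y1 a).
Hypothesis lDr : forall x, {morph l x : y z / y + z}.
Hypothesis mDr : forall x, {morph m x : y z / y + z}.
Hypothesis lNr : forall x, {morph l x : y / - y}.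
Hypothesis mNr : forall x, {morph m x : y / - y}.
Hypothesis dl : forall x y, d (l x y) = X0 (br x y) - br (X0 x) y - br x (X0 y).
Hypothesis dm : forall x y, d (m x y) = Y0 (br x y) - br (Y0 x) y - br x (Y0 y).
Hypothesis X1act : forall x a,
  X1 (act x a) = l x (d a) + act (X0 x) a + act x (X1 a).
Hypothesis Y1act : forall x a,
  Y1 (act x a) = m x (d a) + act (Y0 x) a + act x (Y1 a).

Let Z0 x := X0 (Y0 x) - Y0 (X0 x).
Let Z1 a := X1 (Y1 a) - Y1 (X1 a).
Let n x y := (X1 (m x y) - m (X0 x) y - m x (X0 y))
             - (Y1 (l x y) - l (Y0 x) y - l x (Y0 y)).

Lemma bracket_br x y : d (n x y) = Z0 (br x y) - br (Z0 x) y - br x (Z0 y).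
Proof.
rewrite /n /Z0 !(dD, dN) -X0d -Y0d !dl !dm.
rewrite !(X0D, Y0D, X0N, Y0N, brDl, brDr, brNl, brNr); zmod.
Qed.

Lemma bracket_act x a :
  n x (d a) = Z1 (act x a) - act (Z0 x) a - act x (Z1 a).
Proof.
have la u b : l u (d b) = X1 (act u b) - act (X0 u) b - act u (X1 b).
  by rewrite X1act; zmod.
have ma u b : m u (d b) = Y1 (act u b) - act (Y0 u) b - act u (Y1 b).
  by rewrite Y1act; zmod.
have X1N b : X1 (- b) = - X1 b.
  have X10 : X1 0 = 0 by apply: (addrI (X1 0)); rewrite -X1D !addr0.
  by apply: (addrI (X1 b)); rewrite -X1D !subrr.
have Y1N b : Y1 (- b) = - Y1 b.
  have Y10 : Y1 0 = 0 by apply: (addrI (Y1 0)); rewrite -Y1D !addr0.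
  by apply: (addrI (Y1 b)); rewrite -Y1D !subrr.
rewrite /n /Z0 /Z1 X0d Y0d !la !ma.
rewrite !(X1D, Y1D, X1N, Y1N, actD, actN, actDl, actNl); zmod.
Qed.

Lemma bracket_l3 : is_l3 X0 X1 l -> is_l3 Y0 Y1 m -> is_l3 Z0 Z1 n.
Proof.
move=> hX hY x y z; rewrite /n /Z0 /Z1 (hY x y z) (hX x y z).
rewrite !X1D !Y1D !X1act !Y1act !hX !hY !dl !dm.
rewrite !(lDr, mDr, actD, l3D, lNr, mNr, actN, l3N).
have e1 u v w : l3 (X0 u) v (Y0 w) = - l3 (X0 u) (Y0 w) v by rewrite l3C23.
have e2 u v w : l3 (Y0 u) (X0 v) w = - l3 (X0 v) (Y0 u) w by rewrite l3C12.
have e3 u v w : l3 (Y0 u) v (X0 w) = l3 (X0 w) (Y0 u) v.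
  by rewrite l3C23 l3C12 opprK.
rewrite !(e1, e2, e3); zmod.
Qed.

End Bracket.

Section Differential.
Hypothesis TD : {morph T : x y / x + y}.
Hypothesis l3C : forall x y z, l3 x y z = l3 y z x.
Hypothesis d_l3 : forall x y z,
  d (l3 x y z) = br x (br y z) + br y (br z x) + br z (br x y).
Hypothesis l3_d : forall x y a,
  l3 x y (d a) = act x (act y a) - act y (act x a) - act (br x y) a.

Lemma differential_l3 :
  is_l3 (fun x => d (T x)) (fun a => T (d a))
    (fun x y => T (br x y) - act x (T y) + act y (T x)).
Proof.
move=> x y z; rewrite /= d_l3 !TD.
by rewrite !(l3C (d _)) !l3_d !(actD, actN); zmod.
Qed.

End Differential.
End DerivationIdentities.

Section Derivations.
Variables (F : fieldType) (g : lie2Alg F).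

Local Notation g0 := (lie2_0 g).
Local Notation g1 := (lie2_1 g).
Local Notation d := (@lie2_d F g).
Local Notation br := (@lie2_br F g).
Local Notation act := (@lie2_act F g).
Local Notation l3 := (@lie2_l3 F g).

Definition der_triple : Type :=
  ('End(g0) * 'End(g1) * 'Hom(g0, 'Hom(g0, g1)))%type.

HB.instance Definition _ := GRing.Lmodule.on der_triple.

Implicit Types X Y : der_triple.

Record is_der0 X : Prop := IsDer0 {
  der0_d : (X.1.1 \o d = d \o X.1.2)%VF;
  der0_alt : forall x, X.2 x x = 0;
  der0_br : forall x y,
    d (X.2 x y) = X.1.1 (br x y) - br (X.1.1 x) y - br x (X.1.1 y);
  der0_act : forall x a,
    X.2 x (d a) = X.1.2 (act x a) - act (X.1.1 x) a - act x (X.1.2 a);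
  der0_l3 : forall x y z,
    let c u v w := X.2 u (br v w) + act u (X.2 v w) + l3 (X.1.1 u) v w in
    X.1.2 (l3 x y z) = c x y z + c y z x + c z x y
}.

Definition lie_der X (w : 'Hom(g0, 'Hom(g0, g1))) : 'Hom(g0, 'Hom(g0, g1)) :=
  bilin (fun x y => X.1.2 (w x y) - w (X.1.1 x) y - w x (X.1.1 y)).

Definition der_bracket X Y : der_triple :=
  (((X.1.1 \o Y.1.1) - (Y.1.1 \o X.1.1))%VF,
   ((X.1.2 \o Y.1.2) - (Y.1.2 \o X.1.2))%VF,
   lie_der X Y.2 - lie_der Y X.2).

Let lin_aux (V : lmodType F) a (p q r p' q' r' : V) :
  a *: (p - q - r) + (p' - q' - r') =
  (a *: p + p') - (a *: q + q') - (a *: r + r').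
Proof. by rewrite !scalerDr !scalerN; zmod. Qed.

Lemma lie_derE X w x y :
  lie_der X w x y = X.1.2 (w x y) - w (X.1.1 x) y - w x (X.1.1 y).
Proof.
by apply: bilinE => [u|v] a u1 v1; rewrite ?(hom_simp, lfun_simp) lin_aux.
Qed.

Lemma brC x y : br x y = - br y x.
Proof.
have := lie2_brxx (x + y).
rewrite ?(hom_simp, lfun_simp) !lie2_brxx add0r addr0.
by move/eqP; rewrite addrC addr_eq0 => /eqP.
Qed.

Lemma l3C12 x y z : l3 x y z = - l3 y x z.
Proof.
have := lie2_l3xxy (x + y) z.
rewrite ?(hom_simp, lfun_simp) !lie2_l3xxy add0r addr0.
by move/eqP; rewrite addrC addr_eq0 => /eqP.
Qed.

Lemma l3C23 x y z : l3 x y z = - l3 x z y.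
Proof.
have := lie2_l3xyy x (y + z).
rewrite ?(hom_simp, lfun_simp) !lie2_l3xyy add0r addr0.
by move/eqP; rewrite addrC addr_eq0 => /eqP.
Qed.

Lemma der0C X x y : is_der0 X -> X.2 x y = - X.2 y x.
Proof.
move=> hX; have := der0_alt hX (x + y).
rewrite ?(hom_simp, lfun_simp) !(der0_alt hX) add0r addr0.
by move/eqP; rewrite addrC addr_eq0 => /eqP.
Qed.

Lemma der0_dE X a : is_der0 X -> X.1.1 (d a) = d (X.1.2 a).
Proof. by case=> /lfunP/(_ a); rewrite !comp_lfunE. Qed.

Lemma der0_actE X x a : is_der0 X ->
  X.1.2 (act x a) = X.2 x (d a) + act (X.1.1 x) a + act x (X.1.2 a).
Proof. by move=> hX; rewrite der0_act // addrAC subrK subrK. Qed.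

Lemma is_der0_lin a X Y : is_der0 X -> is_der0 Y -> is_der0 (a *: X + Y).
Proof.
move=> hX hY; split=> /=.
- by apply/lfunP=> b; rewrite !comp_lfunE ?(hom_simp, lfun_simp) !der0_dE.
- by move=> x; rewrite ?(hom_simp, lfun_simp) !der0_alt // scaler0 addr0.
- by move=> x y; rewrite ?(hom_simp, lfun_simp) !der0_br // lin_aux.
- by move=> x b; rewrite ?(hom_simp, lfun_simp) !der0_act // lin_aux.
- move=> x y z.
  have aux (V : lmodType F)
      (p1 p2 p3 p4 p5 p6 p7 p8 p9 q1 q2 q3 q4 q5 q6 q7 q8 q9 : V) :
    a *: (p1 + p2 + p3 + (p4 + p5 + p6) + (p7 + p8 + p9))
      + (q1 + q2 + q3 + (q4 + q5 + q6) + (q7 + q8 + q9)) =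
    (a *: p1 + q1) + (a *: p2 + q2) + (a *: p3 + q3)
      + ((a *: p4 + q4) + (a *: p5 + q5) + (a *: p6 + q6))
      + ((a *: p7 + q7) + (a *: p8 + q8) + (a *: p9 + q9)).
    by rewrite !scalerDr; zmod.
  have actL u b c : act u (a *: b + c) = a *: act u b + act u c.
    exact: linearP.
  have l3L u u' v w : l3 (a *: u + u') v w = a *: l3 u v w + l3 u' v w.
    by rewrite linearP !lfun_simp.
  rewrite !lfun_simp (der0_l3 hX) (der0_l3 hY) /= !actL !l3L.
  exact: aux.
Qed.

Let homD (U V : vectType F) (f : 'Hom(U, V)) : {morph f : x y / x + y}.
Proof. by move=> x y; rewrite hom_simp. Qed.
Let homN (U V : vectType F) (f : 'Hom(U, V)) : {morph f : x / - x}.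
Proof. by move=> x; rewrite hom_simp. Qed.
Let homDl (U V W : vectType F) (f : 'Hom(U, 'Hom(V, W))) v :
  {morph f^~ v : x y / x + y}.
Proof. by move=> x y; rewrite hom_simp lfun_simp. Qed.
Let homNl (U V W : vectType F) (f : 'Hom(U, 'Hom(V, W))) v :
  {morph f^~ v : x / - x}.
Proof. by move=> x; rewrite hom_simp lfun_simp. Qed.
Let l3Dl y z : {morph (fun x => l3 x y z) : x x' / x + x'}.
Proof. by move=> x x'; rewrite hom_simp !lfun_simp. Qed.
Let l3Nl y z : {morph (fun x => l3 x y z) : x / - x}.
Proof. by move=> x; rewrite hom_simp !lfun_simp. Qed.

Lemma is_der0_bracket X Y : is_der0 X -> is_der0 Y -> is_der0 (der_bracket X Y).
Proof.
move=> hX hY; split=> /=.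
- by apply/lfunP=> b; rewrite ?(comp_lfunE, hom_simp, lfun_simp) !der0_dE.
- move=> x; rewrite ?(hom_simp, lfun_simp) !lie_derE !der0_alt //.
  by rewrite (der0C x _ hX) (der0C x _ hY) ?hom_simp; zmod.
- move=> x y; rewrite ?(comp_lfunE, lfun_simp) !lie_derE.
  apply: (@bracket_br _ _ d (fun x y => br x y) X.1.1 Y.1.1 X.1.2 Y.1.2
    (fun u v => X.2 u v) (fun u v => Y.2 u v)) => *;
    by [exact: homD|exact: homN|exact: homDl|exact: homNl|exact: der0_dE
       |exact: der0_br].
- move=> x b; rewrite ?(comp_lfunE, lfun_simp) !lie_derE.
  apply: (@bracket_act _ _ d (fun x a => act x a) X.1.1 Y.1.1 X.1.2 Y.1.2
    (fun u v => X.2 u v) (fun u v => Y.2 u v)) => *;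
    by [exact: homD|exact: homN|exact: homDl|exact: homNl|exact: der0_dE
       |exact: der0_actE].
- move=> x y z; rewrite ?(comp_lfunE, lfun_simp) !lie_derE.
  apply: (@bracket_l3 _ _ d (fun x y => br x y) (fun x a => act x a)
    (fun x y z => l3 x y z) X.1.1 Y.1.1 X.1.2 Y.1.2
    (fun u v => X.2 u v) (fun u v => Y.2 u v)) => *;
    by [exact: homD|exact: homN|exact: l3Dl|exact: l3Nl|exact: l3C12
       |exact: l3C23|exact: der0_br|exact: der0_actE|exact: der0_l3].
Qed.

Lemma der_triple_eq X Y :
  X.1.1 = Y.1.1 -> X.1.2 = Y.1.2 -> X.2 = Y.2 -> X = Y.
Proof. by case: X Y => [[? ?] ?] [[? ?] ?] /= -> -> ->. Qed.

Lemma der_bracketxx X : der_bracket X X = 0.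
Proof. by apply: der_triple_eq; rewrite /= subrr. Qed.

Lemma lie_der_linear X : linear (lie_der X).
Proof.
move=> a v w; apply/lfunP=> x; apply/lfunP=> y.
have e u : X.1.2 (a *: u.1 + u.2) = a *: X.1.2 u.1 + X.1.2 u.2.
  exact: linearP.
rewrite !lfun_simp !lie_derE !lfun_simp (e (v x y, w x y)).
by rewrite lin_aux.
Qed.

Lemma lie_der_linear_l (w : 'Hom(g0, 'Hom(g0, g1))) : linear (lie_der^~ w).
Proof.
move=> a X Y; apply/lfunP=> x; apply/lfunP=> y.
have e1 u v : w (a *: u + v) y = a *: w u y + w v y.
  by rewrite linearP !lfun_simp.
have e2 u v : w x (a *: u + v) = a *: w x u + w x v by exact: linearP.
by rewrite !lfun_simp !lie_derE /= !lfun_simp e1 e2 lin_aux.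
Qed.

Lemma der_bracketC X Y : der_bracket X Y = - der_bracket Y X.
Proof.
by apply: der_triple_eq; rewrite /= opprB.
Qed.

Lemma der_bracket_linear X : linear (der_bracket X).
Proof.
move=> a Y Z; have aux (V : lmodType F) (p q p' q' : V) :
    a *: p + p' - (a *: q + q') = a *: (p - q) + (p' - q').
  by rewrite scalerDr scalerN; zmod.
apply: der_triple_eq; rewrite /=.
- by rewrite comp_lfunDl comp_lfunDr -comp_lfunZl -comp_lfunZr aux.
- by rewrite comp_lfunDl comp_lfunDr -comp_lfunZl -comp_lfunZr aux.
- by rewrite lie_der_linear lie_der_linear_l aux.
Qed.

Lemma der_bracket_linear_l Y : linear (der_bracket^~ Y).
Proof.
move=> a X Z; rewrite !(der_bracketC _ Y) der_bracket_linear.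
by rewrite opprD scalerN.
Qed.

Lemma der_bracket_jacobi X Y Z :
  der_bracket X (der_bracket Y Z) + der_bracket Y (der_bracket Z X)
  + der_bracket Z (der_bracket X Y) = 0.
Proof.
have com_jacobi (V : vectType F) (f h k : 'End(V)) :
  ((f \o ((h \o k) - (k \o h))) - (((h \o k) - (k \o h)) \o f)
   + ((h \o ((k \o f) - (f \o k))) - (((k \o f) - (f \o k)) \o h))
   + ((k \o ((f \o h) - (h \o f))) - (((f \o h) - (h \o f)) \o k)) = 0)%VF.
  apply/lfunP=> x; rewrite !(comp_lfunE, lfun_simp).
  by apply: (@commutator_jacobi _ f h k) => *; first [exact: homD|exact: homN].
apply: der_triple_eq => /=; [exact: com_jacobi|exact: com_jacobi|].
apply/lfunP=> x; apply/lfunP=> y.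
rewrite /= ?(comp_lfunE, lfun_simp) !lie_derE /= ?(comp_lfunE, lfun_simp).
rewrite !lie_derE.
apply: (@bracket_jacobi _ _ X.1.1 Y.1.1 Z.1.1 X.1.2 Y.1.2 Z.1.2
    (fun u v => X.2 u v) (fun u v => Y.2 u v) (fun u v => Z.2 u v)) => *;
  by [exact: homD|exact: homN|exact: homDl|exact: homNl].
Qed.

Lemma is_der0_0 : is_der0 (0 : der_triple).
Proof.
split=> /=.
- by apply/lfunP=> a; rewrite !comp_lfunE !lfunE /= linear0.
- by move=> x; rewrite !lfun_simp.
- by move=> x y; rewrite !lfun_simp ?hom_simp !lfun_simp !subr0.
- by move=> x a; rewrite !lfun_simp ?hom_simp !lfun_simp !subr0.
- by move=> x y z; rewrite !lfun_simp ?hom_simp !lfun_simp !addr0.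
Qed.

(** [der_delta T] is [l_(delta T)]; the term [- [T x, y]] of the degree
    [-1 x 0] bracket reads [+ act y (T x)]. *)
Definition der_delta (T : 'Hom(g0, g1)) : 'Hom(g0, 'Hom(g0, g1)) :=
  bilin (fun x y => T (br x y) - act x (T y) + act y (T x)).

Lemma der_deltaE T x y :
  der_delta T x y = T (br x y) - act x (T y) + act y (T x).
Proof.
have aux (V : lmodType F) a (p q r p' q' r' : V) :
    (a *: p + p') - (a *: q + q') + (a *: r + r') =
    a *: (p - q + r) + (p' - q' + r').
  by rewrite !scalerDr !scalerN; zmod.
by apply: bilinE => [u|v] a u1 v1; rewrite ?(hom_simp, lfun_simp) aux.
Qed.

Definition der_diff (T : 'Hom(g0, g1)) : der_triple :=
  ((d \o T)%VF, (T \o d)%VF, der_delta T).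

Lemma is_der0_diff T : is_der0 (der_diff T).
Proof.
split=> /=.
- by apply/lfunP=> a; rewrite !comp_lfunE.
- by move=> x; rewrite der_deltaE lie2_brxx linear0 sub0r addNr.
- move=> x y; rewrite der_deltaE !comp_lfunE ?hom_simp !lie2_d_act.
  by rewrite (brC y); zmod.
- move=> x a; rewrite der_deltaE !comp_lfunE lie2_d_act (lie2_act_d a) ?hom_simp.
  zmod.
- move=> x y z; rewrite !der_deltaE !comp_lfunE.
  apply: (@differential_l3 _ _ d (fun x y => br x y) (fun x a => act x a)
    (fun x y z => l3 x y z) T) => *;
    by [exact: homD|exact: homN|rewrite l3C12 l3C23 opprK
       |exact: lie2_jac0|exact: lie2_jac1].
Qed.

End Derivations.

Section DerivationLie2.
Variables (F : fieldType) (g : lie2Alg F).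

Definition der0_pred : pred (der_triple g) := fun X => `[< is_der0 X >].

Fact der0_submod_closed : submod_closed der0_pred.
Proof.
split=> [|a X Y /asboolP hX /asboolP hY].
  by apply/asboolP; apply: is_der0_0.
by apply/asboolP; apply: is_der0_lin.
Qed.

HB.instance Definition _ :=
  GRing.isSubmodClosed.Build F (der_triple g) der0_pred der0_submod_closed.

Record der0 : Type := Der0 { der0_val :> der_triple g; _ : der0_pred der0_val }.

HB.instance Definition _ := [isSub for der0_val].
HB.instance Definition _ := [Choice of der0 by <:].
HB.instance Definition _ := [SubChoice_isSubLmodule of der0 by <:].

Lemma der0P (X : der0) : is_der0 X.
Proof. by apply/asboolP; case: X. Qed.

Definition der0_of X (hX : is_der0 X) : der0 := Der0 (asboolT hX).

Definition der0_bracket (X Y : der0) : der0 :=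
  der0_of (is_der0_bracket (der0P X) (der0P Y)).

Fact der0_bracket_linear_l (Y : der0) : linear (der0_bracket^~ Y).
Proof. by move=> a X Z; apply: val_inj; apply: der_bracket_linear_l. Qed.

Fact der0_bracket_linear_r (X : der0) : linear (der0_bracket X).
Proof. by move=> a Y Z; apply: val_inj; apply: der_bracket_linear. Qed.

Fact der0_bracketxx (X : der0) : der0_bracket X X = 0.
Proof. by apply: val_inj; apply: der_bracketxx. Qed.

Fact der0_jacobi (X Y Z : der0) :
  der0_bracket X (der0_bracket Y Z) + der0_bracket Y (der0_bracket Z X)
  + der0_bracket Z (der0_bracket X Y) = 0.
Proof. by apply: val_inj; apply: der_bracket_jacobi. Qed.

HB.instance Definition _ := isLieAlgebra.Build F der0
  der0_bracket_linear_l der0_bracket_linear_r der0_bracketxx der0_jacobi.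

Definition der1 : Type := 'Hom(lie2_0 g, lie2_1 g).

HB.instance Definition _ := Vector.on der1.

Definition der1_bracket (T T' : der1) : der1 :=
  ((T \o lie2_d \o T') - (T' \o lie2_d \o T))%VF.

Fact der1_bracketxx (T : der1) : der1_bracket T T = 0.
Proof. exact: subrr. Qed.

Fact der1_bracketC (T T' : der1) : der1_bracket T T' = - der1_bracket T' T.
Proof. by rewrite /der1_bracket opprB. Qed.

Fact der1_bracket_linear_r (T : der1) : linear (der1_bracket T).
Proof.
move=> a T1 T2; rewrite /der1_bracket.
rewrite comp_lfunDr -comp_lfunZr !comp_lfunDl -!comp_lfunZl.
by rewrite scalerBr opprD addrACA.
Qed.

Fact der1_bracket_linear_l (T : der1) : linear (der1_bracket^~ T).
Proof.
move=> a T1 T2; rewrite !(der1_bracketC _ T) der1_bracket_linear_r.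
by rewrite opprD scalerN.
Qed.

Fact der1_jacobi (T1 T2 T3 : der1) :
  der1_bracket T1 (der1_bracket T2 T3) + der1_bracket T2 (der1_bracket T3 T1)
  + der1_bracket T3 (der1_bracket T1 T2) = 0.
Proof.
rewrite /der1_bracket !(comp_lfunDl, comp_lfunDr, comp_lfunNl, comp_lfunNr).
by rewrite !comp_lfunA; zmod.
Qed.

HB.instance Definition _ := isLieAlgebra.Build F der1
  der1_bracket_linear_l der1_bracket_linear_r der1_bracketxx der1_jacobi.

Definition der_dbar (T : der1) : der0 := der0_of (is_der0_diff T).

End DerivationLie2.

Arguments der_dbar {F} g T.

Section CoadjointSemidirect.
Variables (F : fieldType) (k : finLieAlgType F).

Definition coad_sdprod : Type := (k * dual k)%type.

HB.instance Definition _ := Vector.on coad_sdprod.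

Definition sd_bracket (u v : coad_sdprod) : coad_sdprod :=
  (lie u.1 v.1, coad u.1 v.2 - coad v.1 u.2).

Fact sd_bracketxx u : sd_bracket u u = 0.
Proof. by rewrite /sd_bracket liexx subrr. Qed.

Fact sd_bracketC u v : sd_bracket u v = - sd_bracket v u.
Proof.
apply/eqP; rewrite -[_ == _]/((_ == _) && (_ == _)) /=.
by rewrite lieC eqxx opprB eqxx.
Qed.

Fact sd_bracket_linear_r u : linear (sd_bracket u).
Proof.
move=> a v w; apply/eqP; rewrite -[_ == _]/((_ == _) && (_ == _)) /=.
rewrite lieDr lieZr eqxx /=; apply/eqP/lfunP=> x.
rewrite !lfun_simp !coadE !lfun_simp lieDl lieZl hom_simp.
have aux (V : lmodType F) (p q p' q' : V) :
  - (a *: p + p') - - (a *: q + q') = a *: (- p - - q) + (- p' - - q').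
  by rewrite scalerDr !scalerN !opprK opprD addrACA.
by rewrite -aux [u.2 (_ *: _)]linearZ.
Qed.

Fact sd_bracket_linear_l u : linear (sd_bracket^~ u).
Proof.
move=> a v w; rewrite !(sd_bracketC _ u) sd_bracket_linear_r.
by rewrite opprD scalerN.
Qed.

Fact sd_jacobi u v w :
  sd_bracket u (sd_bracket v w) + sd_bracket v (sd_bracket w u)
  + sd_bracket w (sd_bracket u v) = 0.
Proof.
apply/eqP; rewrite -[_ == _]/((_ == _) && (_ == _)) /=.
rewrite lie_jacobi eqxx /=; apply/eqP/lfunP=> x.
rewrite !lfun_simp !coadE !lfun_simp !coadE.
have e (p q : k) (xi : dual k) :
  xi (lie (lie p q) x) = xi (lie p (lie q x)) - xi (lie q (lie p x)).
  have /lfunP/(_ x) := ad_lie p q; rewrite !lfun_simp !comp_lfunE !adE => ->.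
  by rewrite linearB.
by rewrite !e; zmod.
Qed.

HB.instance Definition _ := isLieAlgebra.Build F coad_sdprod
  sd_bracket_linear_l sd_bracket_linear_r sd_bracketxx sd_jacobi.

End CoadjointSemidirect.

Section String.
Variables (F : fieldType) (k : finLieAlgType F).

Definition string_d : 'Hom(F^o, k) := 0.
Definition string_act : 'Hom(k, 'End(F^o)) := 0.

Definition string_br : 'Hom(k, 'End(k)) := bilin (@lie F k).
Definition string_l3 : 'Hom(k, 'Hom(k, 'Hom(k, F^o))) :=
  trilin (fun x y z : k => killing (lie x y) z : F^o).

Lemma string_brE x y : string_br x y = lie x y.
Proof. by apply: bilinE; [apply: lie_linear_r|apply: lie_linear_l]. Qed.

Lemma string_l3E x y z : string_l3 x y z = killing (lie x y) z.
Proof.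
apply: trilinE => [{}x {}y|{}x {}z|{}y {}z] a u v.
- exact: killing_linear_r.
- by rewrite lieDr lieZr killing_linear_l.
- by rewrite lieDl lieZl killing_linear_l.
Qed.

Let killing0l (x : k) : killing 0 x = 0.
Proof.
have := killing_linear_l x 1 0 0; rewrite /= !scale1r addr0 => e.
by apply: (addrI (killing 0 x)); rewrite addr0 -[LHS]e.
Qed.

Fact string_brxx (x : k) : string_br x x = 0.
Proof. by rewrite string_brE liexx. Qed.

Fact string_l3xxy (x y : k) : string_l3 x x y = 0.
Proof. by rewrite string_l3E liexx killing0l. Qed.

Fact string_l3xyy (x y : k) : string_l3 x y y = 0.
Proof. by rewrite string_l3E killing_inv liexx killingC killing0l. Qed.

Lemma string_dE (a : F^o) : string_d a = 0.
Proof. by rewrite /string_d lfun_simp. Qed.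
Lemma string_actE (x : k) (a : F^o) : string_act x a = 0.
Proof. by rewrite /string_act !lfun_simp. Qed.

Fact string_d_act (x : k) (a : F^o) :
  string_d (string_act x a) = string_br x (string_d a).
Proof. by rewrite !string_dE linear0. Qed.

Fact string_act_d (a b : F^o) :
  string_act (string_d a) b = - string_act (string_d b) a.
Proof. by rewrite !string_actE oppr0. Qed.

Fact string_jac0 (x y z : k) :
  string_d (string_l3 x y z) =
    string_br x (string_br y z) + string_br y (string_br z x)
    + string_br z (string_br x y).
Proof. by rewrite string_dE !string_brE lie_jacobi. Qed.

Fact string_jac1 (x y : k) (a : F^o) :
  string_l3 x y (string_d a) =
    string_act x (string_act y a) - string_act y (string_act x a)
    - string_act (string_br x y) a.
Proof. by rewrite string_dE linear0 !string_actE !subr0. Qed.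

Fact string_l3_closed (x y z t : k) :
  string_act x (string_l3 y z t) - string_act y (string_l3 x z t)
  + string_act z (string_l3 x y t) - string_act t (string_l3 x y z) =
  string_l3 (string_br x y) z t - string_l3 (string_br x z) y t
  + string_l3 (string_br x t) y z + string_l3 (string_br y z) x t
  - string_l3 (string_br y t) x z + string_l3 (string_br z t) x y.
Proof.
rewrite !string_actE !string_l3E !string_brE !subr0 addr0.
have e (a b u v : k) : killing (lie (lie a b) u) v = killing (lie a b) (lie u v).
  exact: killing_inv.
rewrite !e !(killingC (lie y _)) !(killingC (lie z t)) !killing_inv.
set p := killing x _; set q := killing x _; set r := killing x _.
have h : p - q + r = 0 :> F.
  have kD u v : killing x (u + v) = killing x u + killing x v.
    by have := killing_linear_r x 1 u v; rewrite /= !scale1r.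
  have kN u : killing x (- u) = - killing x u.
    have := killing_linear_r x (-1) u 0.
    by rewrite /= !scaleN1r addr0 [killing x 0]killingC killing0l addr0.
  have := lie_jacobi y z t; rewrite [lie t y]lieC lieNr => J.
  by rewrite /p /q /r -kN -!kD J killingC killing0l.
have aux (V : zmodType) (a b c : V) :
    a - b + c = 0 -> 0 = a - b + c + c - b + a.
  move=> h0; have -> : a - b + c + c - b + a = (a - b + c) + (a - b + c) by zmod.
  by rewrite h0 addr0.
exact: aux h.
Qed.

Definition string_lie2 : lie2Alg F :=
  @Lie2Alg F k F^o string_d string_br string_act string_l3
    string_brxx string_l3xxy string_l3xyy string_d_act string_act_d
    string_jac0 string_jac1 string_l3_closed.

End String.

(* Main.v *)
From HB Require Import structures.
Require Import Defs.
From mathcomp Require Import all_boot all_order all_algebra reals.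
From mathcomp Require Import spectral complex boolp ring zify.

(** The heart of the proof is Cartan's criterion: a real Lie algebra without
    solvable ideals has a nondegenerate Killing form [K].  If [N] is the radical
    of [K] and [x] is in [[N, N]], let [P] be the complex conjugate of the
    semisimple part of [ad x]; it is a derivation of the complexified algebra,
    so the trace of [ad x \o P], which is the sum of the squared moduli of the
    eigenvalues of [ad x], reduces to values of [K] on [N] and vanishes.  Hence
    [ad x] is nilpotent, and by Engel's theorem a perfect ideal inside [N] is
    zero; so [N] is solvable, and therefore zero.

    Nondegeneracy makes derivations inner.  In a degree-0 derivation
    [(X0, X1, l)] of the string algebra, [X0] is then [ad u], and by invariance
    [X1 = c] satisfies [c K([x,y],z) = l(x,[y,z]) + cyclic].  Writing
    [l(x,y) = K(Dx,y)], the map [D - c] is a derivation, whence [c = 0] and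
    [l(x,y) = K(v,[x,y])]: the triple is the image of a point of the semidirect
    product. *)

Set Implicit Arguments.
Unset Strict Implicit.
Unset Printing Implicit Defensive.

Import Order.TTheory GRing.Theory Num.Theory passmx.
Local Open Scope ring_scope.

(** * Interpolation modulo powers of linear factors *)

Lemma coprimep_XsubC_exp_prod (F : fieldType) (s : seq F) (e : F -> nat) m a :
  a \notin s ->
  coprimep (('X - a%:P) ^+ m) (\prod_(b <- s) ('X - b%:P) ^+ e b).
Proof.
move=> as'; rewrite big_seq; elim/big_ind: _ => [|p q|b bs].
- exact: coprimep1.
- by rewrite coprimepMr => -> ->.
- rewrite coprimep_expl // coprimep_expr // coprimep_XsubC2 // subr_eq0.
  by apply: contraNneq as' => <-.
Qed.

(** Chinese remainder theorem, one node at a time. The exponent [m] makes [p], evaluated at a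
    matrix, act as the scalar [f a] on generalized eigenvectors and not only on eigenvectors. *)
Lemma poly_interpolation_mod (F : fieldType) (f : F -> F) m (s : seq F) :
  uniq s -> exists p : {poly F},
    forall a, a \in s -> ('X - a%:P) ^+ m %| p - (f a)%:P.
Proof.
elim: s => [|a s IH] /=; first by exists 0.
case/andP=> as' /IH[p hp].
have /Bezout_eq1_coprimepP[[u v] /= e] :=
  coprimep_XsubC_exp_prod (fun=> m) m as'.
set q := _ ^+ m in e; set Q := \prod_(_ <- _) _ in e.
exists (p + ((f a)%:P - p) * (v * Q)) => b; rewrite inE.
case/orP=> [/eqP->|bs].
  have -> : v * Q = 1 - u * q by rewrite -e addrC addKr.
  have -> : p + ((f a)%:P - p) * (1 - u * q) - (f a)%:P
      = (p - (f a)%:P) * u * q by rewrite mulrBr mulr1; ring.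
  exact: dvdp_mull.
rewrite addrAC dvdp_add ?hp // mulrA dvdp_mull // /Q.
by rewrite (big_rem b) //= dvdp_mulr.
Qed.

(** * Generalized eigenvectors of a matrix *)

Section GeneralizedEigenvectors.
Variables (F : fieldType) (n : nat).
Implicit Types (A B P : 'M[F]_n.+1) (u v w : 'rV[F]_n.+1).

(** Primary decomposition as an induction principle: a Bezout relation splits [v] into a vector
    killed by the factor of [a] and one killed by the other factors. *)
Lemma geigen_decomposition_ind A (s : seq F) (e : F -> nat)
    (Q : 'rV[F]_n.+1 -> Prop) :
  uniq s -> Q 0 -> (forall u v, Q u -> Q v -> Q (u + v)) ->
  (forall a v, a \in s -> v *m horner_mx A (('X - a%:P) ^+ e a) = 0 -> Q v) ->
  forall v, v *m horner_mx A (\prod_(a <- s) ('X - a%:P) ^+ e a) = 0 -> Q v.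
Proof.
move=> + Q0 QD; elim: s => [|a s IH] /= => [_ _ v|/andP[as' us] Qs v].
  by rewrite big_nil rmorph1 mulmx1 => ->.
rewrite big_cons => v0.
have /Bezout_eq1_coprimepP[[p q] /= pq] := coprimep_XsubC_exp_prod e (e a) as'.
set X := _ ^+ _ in pq v0; set Y := \prod_(_ <- _) _ in pq v0.
rewrite -[v]mulmx1 -[1%:M](rmorph1 (horner_mx A)) -pq rmorphD mulmxDr.
apply: QD.
  apply: IH => // [b w bs|]; first by apply: Qs; rewrite inE bs orbT.
  rewrite -mulmxA mulmxE -rmorphM.
  have -> : p * X * Y = X * Y * p by ring.
  by rewrite rmorphM -mulmxE mulmxA v0 mul0mx.
apply: (Qs a); first by rewrite inE eqxx.
rewrite -mulmxA mulmxE -rmorphM.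
have -> : q * Y * X = X * Y * q by ring.
by rewrite rmorphM -mulmxE mulmxA v0 mul0mx.
Qed.

Lemma geigen_horner A (p : {poly F}) a b m i v : (i <= m)%N ->
  ('X - a%:P) ^+ m %| p - b%:P ->
  v *m horner_mx A (('X - a%:P) ^+ i) = 0 -> v *m horner_mx A p = b *: v.
Proof.
move=> im /dvdpP[q e] v0.
rewrite -[p](subrK b%:P) e -(subnKC im) exprD.
have -> : q * (('X - a%:P) ^+ i * ('X - a%:P) ^+ (m - i)) =
  ('X - a%:P) ^+ i * (q * ('X - a%:P) ^+ (m - i)) by ring.
by rewrite rmorphD mulmxDr rmorphM -mulmxE mulmxA v0 mul0mx add0r /=
  horner_mx_C mul_mx_scalar.
Qed.

(* [w *m M v] plays the role of a bilinear product [v . w], and the hypothesis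
   on [M] says that right multiplication by [A] is a derivation of it. *)
Variables (M : {linear 'rV[F]_n.+1 -> 'M[F]_n.+1}) (A : 'M[F]_n.+1).
Hypothesis derA : forall v, M v *m A - A *m M v = M (v *m A).

(** [A - (a + b)] acts on a product as [A - a] on one factor plus [A - b] on the other, so each
    application lowers one of the exponents. *)
Lemma geigen_mul a b i j v w :
  v *m horner_mx A (('X - a%:P) ^+ i) = 0 ->
  w *m horner_mx A (('X - b%:P) ^+ j) = 0 ->
  w *m M v *m horner_mx A (('X - (a + b)%:P) ^+ (i + j)) = 0.
Proof.
have stepE c u : u *m horner_mx A ('X - c%:P) = u *m A - c *: u.
  by rewrite rmorphB /= horner_mx_X horner_mx_C mulmxBr mul_mx_scalar.
have [m le_m] := ubnP (i + j); elim: m => // m IH in i j v w le_m *.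
case: i => [|i] in le_m *.
  by rewrite expr0 rmorph1 mulmx1 => -> _; rewrite linear0 mulmx0 mul0mx.
case: j => [|j] in le_m *.
  by move=> _; rewrite expr0 rmorph1 mulmx1 => ->; rewrite !mul0mx.
rewrite [_ ^+ i.+1]exprS [_ ^+ j.+1]exprS => v0 w0.
have e : w *m M v *m horner_mx A ('X - (a + b)%:P) =
    w *m M (v *m horner_mx A ('X - a%:P)) +
    (w *m horner_mx A ('X - b%:P)) *m M v.
  rewrite !stepE linearB linearZ /= -derA mulmxBl !mulmxBr !mulmxA.
  rewrite linearZ_LR -scalemxAl -scalemxAr scalerDl !scalerN.
  by rewrite !addrA [X in _ = X - _]addrAC subrK.
rewrite addnS exprS rmorphM -mulmxE mulmxA e mulmxDl.
have splitE u c l : u *m horner_mx A (('X - c%:P) * ('X - c%:P) ^+ l) =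
    u *m horner_mx A ('X - c%:P) *m horner_mx A (('X - c%:P) ^+ l).
  by rewrite rmorphM -mulmxE mulmxA.
rewrite !splitE in v0 w0; have IHl := IH i j.+1 _ w le_m v0.
rewrite addSnnS IHl ?add0r ?exprS ?splitE // -addSnnS.
by apply: IH => //; rewrite ?exprS ?splitE // addSnnS.
Qed.

End GeneralizedEigenvectors.

(** * Nilpotency from vanishing traces *)

Lemma trig_horner_mx (F : fieldType) n (T : 'M[F]_n.+1) (p : {poly F}) :
  is_trig_mx T ->
  is_trig_mx (horner_mx T p) /\ forall i, horner_mx T p i i = p.[T i i].
Proof.
move=> /is_trig_mxP trT; elim/poly_ind: p => [|p c [/is_trig_mxP trp dp]].
  by rewrite rmorph0; split=> [|i]; rewrite ?mx0_is_trig // mxE horner0.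
rewrite rmorphD rmorphM /= horner_mx_X horner_mx_C -mulmxE; split=> [|i].
  apply/is_trig_mxP=> i j ij; rewrite !mxE -val_eqE (ltn_eqF ij) addr0.
  rewrite big1 // => l _.
  have [il|li] := ltnP i l; first by rewrite trp ?mul0r.
  by rewrite (trT l) ?mulr0 // (leq_ltn_trans li).
rewrite !mxE eqxx hornerMXaddC -dp (bigD1 i) //= big1 ?addr0 // => l /=.
rewrite -val_eqE neq_ltn => /orP[li|il]; first by rewrite (trT l) ?mulr0.
by rewrite trp ?mul0r.
Qed.

(* The derivation [P] fed to the hypothesis is the complex conjugate of the
   semisimple part of [A]: it is additive in the eigenvalues, hence again a
   derivation, and [\tr (A *m P)] is the sum of their squared moduli. *)
Lemma derivation_trace_nilpotent (C : numClosedFieldType) n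
    (M : {linear 'rV[C]_n.+1 -> 'M[C]_n.+1}) (A : 'M[C]_n.+1) :
  (forall v, M v *m A - A *m M v = M (v *m A)) ->
  (forall P, (forall v, M v *m P - P *m M v = M (v *m P)) ->
     \tr (A *m P) = 0) ->
  A ^+ n.+1 = 0.
Proof.
move=> derA trA.
have [U /unitarymx_unit Uu] := Schur A (ltn0Sn n).
rewrite /similar_to conjumx //; set T := U *m A *m invmx U => trigT.
have AE q : horner_mx A q = invmx U *m horner_mx T q *m U.
  by rewrite -horner_mx_uconjC // /T !mulmxA mulmxKV // mulVmx // mul1mx.
pose d i := T i i; pose r := [seq d i | i <- index_enum 'I_n.+1].
have charT : char_poly T = \prod_(a <- r) ('X - a%:P).
  by rewrite char_poly_trig // big_map.
have charA : horner_mx A (char_poly T) = 0.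
  by rewrite AE Cayley_Hamilton mulmx0 mul0mx.
pose s := undup r; pose e a := count_mem a r; pose m := (size r + size r)%N.
have geigenA (Q : 'rV[C]_n.+1 -> Prop) : Q 0 ->
    (forall u v, Q u -> Q v -> Q (u + v)) ->
    (forall a v, a \in s -> v *m horner_mx A (('X - a%:P) ^+ e a) = 0 -> Q v) ->
    forall v, Q v.
  move=> Q0 QD Qs v; apply: (@geigen_decomposition_ind _ _ A s e) => //.
    exact: undup_uniq.
  by rewrite prodr_undup_exp_count -charT charA mulmx0.
(* A product of generalized eigenvectors belongs to a sum [a + b], with exponent at most [m]; hence
   the extra nodes and the doubled [size r]. *)
have [p hp] := poly_interpolation_mod Num.conj m
  (undup_uniq (s ++ [seq a + b | a <- s, b <- s])).
have pE a i (v : 'rV_n.+1) :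
    a \in s ++ [seq a + b | a <- s, b <- s] -> (i <= m)%N ->
    v *m horner_mx A (('X - a%:P) ^+ i) = 0 ->
    v *m horner_mx A p = a^* *: v.
  by move=> sa im; apply: (geigen_horner im); rewrite hp // mem_undup.
have em a : (e a <= size r)%N by apply: count_size.
have derP v : M v *m horner_mx A p - horner_mx A p *m M v =
    M (v *m horner_mx A p).
  (* By bilinearity generalized eigenvectors suffice, and there the identity reads
     [(a + b)^* - b^* = a^*]. *)
  apply/row_matrixP=> i; rewrite !rowE; move: (delta_mx _ _) => w.
  rewrite mulmxBr !mulmxA; elim/geigenA: v w => [w|u v IHu IHv w|a v sa v0 w].
  - by rewrite mul0mx [M 0]linear0 !mulmx0 mul0mx subr0.
  - rewrite mulmxDl ![M (_ + _)]linearD !mulmxDr mulmxDl -IHu -IHv.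
    by rewrite opprD addrACA.
  elim/geigenA: w => [|u w IHu IHw|b w sb w0].
  - by rewrite !mul0mx subr0.
  - by rewrite !mulmxDl opprD addrACA IHu IHw.
  have ab := geigen_mul derA v0 w0.
  rewrite (pE _ _ _ _ _ v0) ?(pE _ _ _ _ _ w0) ?(pE _ _ _ _ _ ab).
  - rewrite linearZ_LR /= -scalemxAl -scalemxAr rmorphD /= scalerDl.
    by rewrite addrK.
  - by rewrite mem_cat; apply/orP; right; apply/allpairsP; exists (a, b).
  - exact: leq_add.
  - by rewrite mem_cat sb.
  - exact: leq_trans (em b) (leq_addr _ _).
  - by rewrite mem_cat sa.
  - exact: leq_trans (em a) (leq_addr _ _).
have d0 i : d i = 0.
  have [trig_p diag_p] := trig_horner_mx p trigT.
  have dr j : d j \in r by apply: map_f; rewrite mem_index_enum.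
  have pd j : p.[d j] = (d j)^*.
    have /dvdpP[q] : ('X - (d j)%:P) ^+ m %| p - ((d j)^*)%:P.
      by apply: hp; rewrite mem_undup mem_cat mem_undup dr.
    move/(congr1 (horner^~ (d j))); rewrite !hornerE subrr expr0n.
    have -> : (m == 0%N) = false.
      by rewrite addn_eq0 andbb size_eq0; apply: contraTF (dr j) => /eqP->.
    by rewrite mulr0 => /eqP; rewrite subr_eq0 => /eqP.
  (* In the triangular form the trace is the sum of [d j * (d j)^*], whose nonnegative terms must
     vanish separately. *)
  have := trA _ derP.
  rewrite AE [X in \tr (X *m _)](_ : A = invmx U *m T *m U); last first.
    by rewrite /T !mulmxA mulmxKV // mulVmx // mul1mx.
  rewrite -!mulmxA mxtrace_mulC !mulmxA mulmxK // mulmxK // -/T.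
    have -> : \tr (T *m horner_mx T p) = \sum_j d j * (d j)^*.
    apply: eq_bigr => j _; rewrite mxE (bigD1 j) //= diag_p pd.
    rewrite big1 ?addr0 // => l; rewrite -val_eqE neq_ltn => /orP[lj|jl].
      by rewrite (is_trig_mxP trig_p l j) ?mulr0.
    by rewrite (is_trig_mxP trigT j l) ?mul0r.
  move/psumr_eq0P => /(_ (fun j _ => mul_conjC_ge0 _))/(_ i isT)/eqP.
  by rewrite mul_conjC_eq0 => /eqP.
have := charA; rewrite charT big_map.
under eq_bigr => i _ do rewrite d0 subr0.
by rewrite prodr_const card_ord rmorphXn /= horner_mx_X.
Qed.

Lemma lie_leibniz (F : fieldType) (L : lieAlgType F) (x y z : L) :
  lie x (lie y z) = lie (lie x y) z + lie y (lie x z).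
Proof.
have := lie_jacobi x y z; rewrite [lie z (lie x y)]lieC [lie z x]lieC lieNr.
by move/eqP; rewrite subr_eq0 => /eqP <-; rewrite subrK.
Qed.

(** * Engel's theorem *)

Section Engel.
Variables (F : fieldType) (k : finLieAlgType F).
Implicit Types (x y z w : k) (I J M U W : {vspace k}).

Definition lie_stable J U : Prop :=
  forall x y, x \in J -> y \in U -> lie x y \in U.

Definition ad_nilpotent x : Prop := forall y, exists m, iter m (lie x) y = 0.

(** A nonzero vector of [W / U] killed by [J], phrased without quotients. Quantifying over all
    stable pairs serves both to enlarge subalgebras and to build flags. *)
Definition engel_property J : Prop := forall U W,
  lie_stable J U -> lie_stable J W -> (U <= W)%VS -> U != W ->
  exists2 w, w \in W /\ w \notin U & forall x, x \in J -> lie x w \in U.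

Lemma subv_neq_exists U W :
  (U <= W)%VS -> U != W -> exists2 w, w \in W & w \notin U.
Proof.
move=> sUW neUW; have /subvPn[w wW wU] : ~~ (W <= U)%VS.
  by apply: contraNN neUW => sWU; rewrite eqEsubv sUW.
by exists w.
Qed.

(** Take [v] killed by [M] modulo [U] and apply [lie w] repeatedly. Since [w] normalizes [M], the
    iterates stay killed by [M]; the last one outside [U] is also killed by [w]. *)
Lemma engel_property_add_line M w :
  lie_stable M M -> (forall x, x \in M -> lie x w \in M) ->
  ad_nilpotent w -> engel_property M ->
  lie_stable (M + <[w]>) (M + <[w]>) /\ engel_property (M + <[w]>).
Proof.
move=> MM Mw nw engM.
have MP U z : (forall x, x \in M -> lie x z \in U) -> lie w z \in U ->
    forall x, x \in (M + <[w]>)%VS -> lie x z \in U.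
  move=> Mz wz _ /memv_addP[x xM [_ /vlineP[a ->] ->]].
  by rewrite lieDl lieZl memvD ?memvZ // Mz.
split=> [x y + /memv_addP[y' y'M [_ /vlineP[a ->] ->]]|U W MU MW sUW neUW].
  move: x; apply: MP => [x xM|]; rewrite lieDr lieZr.
  - by rewrite (subvP (addvSl M _)) ?memvD ?memvZ //; [apply: MM|apply: Mw].
  - rewrite liexx scaler0 addr0 lieC memvN.
    by rewrite (subvP (addvSl M _)) // Mw.
have sub_addl x : x \in M -> x \in (M + <[w]>)%VS by apply/subvP/addvSl.
have w_add : w \in (M + <[w]>)%VS by rewrite (subvP (addvSr _ _)) ?memv_line.
have stM V : lie_stable (M + <[w]>) V -> lie_stable M V.
  by move=> MV x y xM; apply: MV; apply: sub_addl.
have [v [vW vU] Mv] := engM U W (stM U MU) (stM W MW) sUW neUW.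
pose v_ m := iter m (lie w) v.
have v_W m : v_ m \in W by elim: m => //= m IH; apply: MW.
have Mv_ m x : x \in M -> lie x (v_ m) \in U.
  elim: m x => [|m IH] x xM /=; first exact: Mv.
  by rewrite lie_leibniz memvD ?IH ?Mw // MU ?IH.
have exU : exists m, v_ m \in U.
  by have [m v0] := nw v; exists m; rewrite /v_ v0 mem0v.
case: (ex_minnP exU) => -[|m] vm min_m; first by rewrite vm in vU.
exists (v_ m); first split=> //; first by apply/negP=> /min_m; rewrite ltnn.
by apply: MP => // x; apply: Mv_.
Qed.

(** A subalgebra [M] with the property grows up to [J]: the property for the pair [M], [J] supplies
    a vector normalizing [M], which extends it by a line. *)
Lemma engel J :
  lie_stable J J -> (forall x, x \in J -> ad_nilpotent x) -> engel_property J.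
Proof.
move=> JJ nJ.
suff asc n : forall M, (M <= J)%VS -> lie_stable M M -> engel_property M ->
    (\dim J - \dim M <= n)%N -> engel_property J.
  apply: (asc (\dim J) 0%VS); rewrite ?sub0v ?leq_subr //.
    by move=> x y; rewrite memv0 => /eqP->; rewrite lie0l mem0v.
  move=> U W _ _ sUW neUW; have [w wW wU] := subv_neq_exists sUW neUW.
  by exists w => // x; rewrite memv0 => /eqP->; rewrite lie0l mem0v.
elim: n => [|n IH] M sMJ MM engM dimM; have [<- //|neMJ] := eqVneq M J.
  case/eqP: neMJ; apply/eqP; rewrite eqEdim sMJ /=.
  by rewrite -subn_eq0 -leqn0.
have MJ : lie_stable M J by move=> x y /(subvP sMJ); apply: JJ.
have [w [wJ wM] Mw] := engM M J MM MJ sMJ neMJ.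
have [MwMw engMw] := engel_property_add_line MM Mw (nJ w wJ) engM.
have sMwJ : (M + <[w]> <= J)%VS by rewrite subv_add sMJ -memvE.
apply: IH MwMw engMw _ => //.
have ltM : (\dim M < \dim (M + <[w]>))%N.
  rewrite ltn_neqAle dimvS ?addvSl // andbT; apply: contraNneq wM => eqd.
  have /eqP -> : M == (M + <[w]>)%VS by rewrite eqEdim addvSl eqd leqnn.
  by rewrite (subvP (addvSr _ _)) ?memv_line.
have := dimvS sMwJ; have := dimvS sMJ; move: dimM ltM; lia.
Qed.

(** Engel's theorem gives a flag from 0 to [k] in which [J] maps each member into the preceding one.
    If [J] lies in a member, then [J = [J, J]] lies in the preceding one, and so on down to 0. *)
Lemma engel_perfect_eq0 J :
  lie_prod J J = J -> (forall x, x \in J -> ad_nilpotent x) -> J = 0%VS.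
Proof.
move=> JJ nJ; have stJ : lie_stable J J.
  by move=> x y xJ yJ; rewrite -JJ lie_in_prod.
have engJ := engel stJ nJ.
suff asc n : forall U, lie_stable J U -> ((J <= U)%VS -> J = 0%VS) ->
    (\dim {:k} - \dim U <= n)%N -> J = 0%VS.
  apply: (asc (\dim {:k}) 0%VS); rewrite ?leq_subr //.
    by move=> x y _; rewrite memv0 => /eqP->; rewrite lie0r mem0v.
  by rewrite subv0 => /eqP.
elim: n => [|n IH] U JU hU dimU; have [eUk|neUk] := eqVneq U fullv.
- by apply: hU; rewrite eUk subvf.
- by case/eqP: neUk; apply/eqP; rewrite eqEdim subvf /= -subn_eq0 -leqn0.
- by apply: hU; rewrite eUk subvf.
have Jk : lie_stable J fullv by move=> x y _ _; rewrite memvf.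
have [w [_ wU] Jw] := engJ U fullv JU Jk (subvf _) neUk.
have ltU : (\dim U < \dim (U + <[w]>))%N.
  rewrite ltn_neqAle dimvS ?addvSl // andbT; apply: contraNneq wU => eqd.
  have /eqP -> : U == (U + <[w]>)%VS by rewrite eqEdim addvSl eqd leqnn.
  by rewrite (subvP (addvSr _ _)) ?memv_line.
have JUw x y : x \in J -> y \in (U + <[w]>)%VS -> lie x y \in U.
  move=> xJ /memv_addP[u uU [_ /vlineP[a ->] ->]].
  by rewrite lieDr lieZr memvD ?memvZ //; [apply: JU|apply: Jw].
apply: (IH (U + <[w]>)%VS).
- by move=> x y xJ yU; rewrite (subvP (addvSl U _)) // JUw.
- move=> sJ; apply: hU; rewrite -JJ; apply: lie_prod_min => x y xJ yJ.
  by apply: JUw => //; apply: (subvP sJ).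
- by have := dimvS (subvf (U + <[w]>)%VS); move: dimU ltU; lia.
Qed.

End Engel.

(** Iterates in place of matrix powers let the statement include dimension 0. *)
Lemma derivation_trace_iter0 (C : numClosedFieldType) n
    (M : {linear 'rV[C]_n -> 'M[C]_n}) (A : 'M[C]_n) :
  (forall v, M v *m A - A *m M v = M (v *m A)) ->
  (forall P, (forall v, M v *m P - P *m M v = M (v *m P)) ->
     \tr (A *m P) = 0) ->
  forall v : 'rV[C]_n, iter n (mulmxr A) v = 0.
Proof.
case: n => [|n] in M A *; first by move=> _ _ v; rewrite [LHS]thinmx0.
move=> derA trA v.
suff iterE m : iter m (mulmxr A) v = v *m A ^+ m.
  by rewrite iterE (derivation_trace_nilpotent derA trA) mulmx0.
elim: m => [|m /= ->]; first by rewrite expr0 mulmx1.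
by rewrite exprSr -mulmxE mulmxA.
Qed.

(** * The radical of the Killing form *)

Section KillingRadical.
Variables (F : fieldType) (k : finLieAlgType F).
Implicit Types (x y z : k) (I J : {vspace k}).

Definition killing_map : 'Hom(k, dual k) :=
  bilin (fun x y => killing x y : F^o).

Lemma killing_mapE x y : killing_map x y = killing x y.
Proof. by apply: bilinE; [apply: killing_linear_r|apply: killing_linear_l]. Qed.

Definition killing_radical : {vspace k} := lker killing_map.

Lemma mem_killing_radical x :
  reflect (forall y, killing x y = 0) (x \in killing_radical).
Proof.
rewrite memv_ker; apply: (iffP eqP) => [x0 y|x0].
  by rewrite -killing_mapE x0 lfunE.
by apply/lfunP=> y; rewrite killing_mapE x0 lfunE.
Qed.

Lemma killing_radical_ideal : is_ideal killing_radical.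
Proof.
move=> x y /mem_killing_radical y0; apply/mem_killing_radical=> z.
by rewrite killingC -killing_inv killingC y0.
Qed.

Lemma lie_prod_ideal I J : is_ideal I -> is_ideal J -> is_ideal (lie_prod I J).
Proof.
move=> idI idJ x z; rewrite -adE memv_preim; move: z.
apply/subvP/lie_prod_min => y z yI zJ; rewrite -memv_preim adE.
by rewrite lie_leibniz memvD ?lie_in_prod ?idI ?idJ.
Qed.

End KillingRadical.

Arguments killing_map {F k}.

(** * Cartan's criterion *)

Section Cartan.
Variables (R : rcfType) (k : finLieAlgType R).
Implicit Types (x y z : k).

Local Notation e := (vbasis {:k}).
Local Notation n := (\dim {:k}).
Local Notation rc := (real_complex R).

Definition complex_ad x : 'M[R[i]]_n := map_mx rc (mxof e e (ad x)).
Definition complex_coord x : 'rV[R[i]]_n := map_mx rc (rVof e x).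

Lemma complex_ad_linear a x y :
  complex_ad (a *: x + y) = rc a *: complex_ad x + complex_ad y.
Proof. by rewrite /complex_ad adD adZ !linearP map_mxD map_mxZ. Qed.

Lemma complex_ad_lie x y :
  complex_ad (lie x y) =
    complex_ad y *m complex_ad x - complex_ad x *m complex_ad y.
Proof.
by rewrite /complex_ad ad_lie linearB /= !(mxof_comp _ _ (vbasisP fullv))
  map_mxB !map_mxM.
Qed.

Lemma complex_ad_sum (I : Type) (s : seq I) (c : I -> R) (f : I -> k) :
  complex_ad (\sum_(i <- s) c i *: f i) =
    \sum_(i <- s) rc (c i) *: complex_ad (f i).
Proof.
elim: s => [|i s IH]; last by rewrite !big_cons complex_ad_linear IH.
have := complex_ad_linear (-1) 0 0; rewrite !big_nil scaler0 addr0 => ->.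
by rewrite rmorphN1 scaleN1r addNr.
Qed.

(** The adjoint representation of the complexified algebra, on coordinate vectors. *)
Definition complex_ad_ext (v : 'rV[R[i]]_n) : 'M[R[i]]_n :=
  \sum_i v 0 i *: complex_ad e`_i.

Fact complex_ad_ext_linear : linear complex_ad_ext.
Proof.
move=> a u v; rewrite /complex_ad_ext scaler_sumr -big_split /=.
by apply: eq_bigr => i _; rewrite !mxE scalerDl scalerA.
Qed.

HB.instance Definition _ := GRing.isLinear.Build _ _ _ _ complex_ad_ext
  complex_ad_ext_linear.

Lemma complex_ad_extE x : complex_ad_ext (complex_coord x) = complex_ad x.
Proof.
rewrite [in RHS](coord_vbasis (memvf x)) complex_ad_sum.
by apply: eq_bigr => i _; rewrite !mxE.
Qed.

Lemma complex_coord_lie x y :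
  complex_coord (lie x y) = complex_coord y *m complex_ad x.
Proof.
by rewrite /complex_coord -adE (rVof_app _ (vbasisP fullv)) map_mxM.
Qed.

Lemma complex_ad_derivation x v :
  complex_ad_ext v *m complex_ad x - complex_ad x *m complex_ad_ext v =
    complex_ad_ext (v *m complex_ad x).
Proof.
rewrite mulmx_suml mulmx_sumr -sumrB [v in RHS]row_sum_delta mulmx_suml.
rewrite linear_sum; apply: eq_bigr => i _.
rewrite -!scalemxAl -scalemxAr -scalerBr linearZ /=; congr (_ *: _).
have -> : delta_mx 0 i = complex_coord e`_i.
  by rewrite /complex_coord (rVofE (vbasisP fullv)) map_delta_mx.
by rewrite -complex_coord_lie complex_ad_extE complex_ad_lie.
Qed.

(** For [x = [y, z]] the trace is [- \tr (Y *m (Z *m P - P *m Z))]. As [P] is a derivation, the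
    commutator is [ad] of a complexified vector, so the trace is a combination of values
    [K(y, e_j)], which vanish. *)
Lemma killing_radical_trace P x :
  (forall v, complex_ad_ext v *m P - P *m complex_ad_ext v =
     complex_ad_ext (v *m P)) ->
  x \in lie_prod (killing_radical k) (killing_radical k) ->
  \tr (complex_ad x *m P) = 0.
Proof.
move=> derP xN; pose s := in_tuple
  [seq lie y z | y <- vbasis (killing_radical k),
                 z <- vbasis (killing_radical k)].
rewrite (coord_span (xN : x \in <<s>>%VS)) complex_ad_sum mulmx_suml linear_sum.
rewrite big1 //= => i _; rewrite -scalemxAl mxtraceZ.
have : s`_i \in s by rewrite mem_nth ?size_tuple.
case/allpairsP=> -[y z] [/= /vbasis_mem/mem_killing_radical y0 _ ->].
rewrite complex_ad_lie; set Y := complex_ad y; set Z := complex_ad z.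
have -> : \tr ((Z *m Y - Y *m Z) *m P) = - \tr (Y *m (Z *m P - P *m Z)).
  have trB (A B : 'M[R[i]]_n) : \tr (A - B) = \tr A - \tr B.
    by rewrite linearB.
  rewrite mulmxBl mulmxBr !trB opprB; congr (_ - _); rewrite -!mulmxA //.
  by rewrite mxtrace_mulC mulmxA.
rewrite {1 2}/Z -complex_ad_extE derP mulmx_sumr [\tr _]raddf_sum.
rewrite big1 ?oppr0 ?mulr0 // => j _.
rewrite -scalemxAr /= mxtraceZ -map_mxM trace_map_mx -killingE killingC y0.
by rewrite rmorph0 mulr0.
Qed.

Lemma killing_radical_prod_nilpotent x :
  x \in lie_prod (killing_radical k) (killing_radical k) -> ad_nilpotent x.
Proof.
move=> xN y; exists n.
have := derivation_trace_iter0 (complex_ad_derivation x)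
  (fun P derP => killing_radical_trace derP xN) (complex_coord y).
have -> m : iter m (mulmxr (complex_ad x)) (complex_coord y) =
    complex_coord (iter m (lie x) y).
  by elim: m => //= m ->; rewrite complex_coord_lie.
by move/eqP; rewrite map_mx_eq0 (rVof_eq0 (vbasisP fullv)) => /eqP.
Qed.

(** Induction on dimension: [[I, I]] is either a smaller ideal or all of [I]. In the latter case [I]
    lies in the derived ideal of the radical, and Engel's theorem gives [I = 0]. *)
Lemma killing_radical_sub_solvable I :
  is_ideal I -> (I <= killing_radical k)%VS -> lie_solvable I.
Proof.
have [m] := ubnP (\dim I); elim: m => // m IH in I * => ltm idI sIN.
have sII : (lie_prod I I <= I)%VS by apply: lie_prod_min => x y _; apply: idI.
have [II|neII] := eqVneq (lie_prod I I) I.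
  exists 0%N; apply: engel_perfect_eq0 => // x; rewrite -II => xII.
  apply: killing_radical_prod_nilpotent; apply: subvP xII.
  by apply: lie_prod_min => y z yI zI; rewrite lie_in_prod ?(subvP sIN).
have [|||j solj] := IH (lie_prod I I).
- rewrite -ltnS (leq_trans _ ltm) // ltnS ltn_neqAle dimvS // andbT.
  by apply: contraNneq neII => eqd; rewrite eqEdim sII eqd leqnn.
- exact: lie_prod_ideal.
- exact: subv_trans sII sIN.
by exists j.+1; rewrite iterSr.
Qed.

Lemma cartan_criterion : semisimple k -> killing_radical k = 0%VS.
Proof.
by apply; [|apply: killing_radical_sub_solvable];
  rewrite ?subvv //; apply: killing_radical_ideal.
Qed.

Lemma killing_eq0 x : semisimple k -> (forall y, killing x y = 0) -> x = 0.
Proof.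
move=> ss /mem_killing_radical; rewrite cartan_criterion //.
by rewrite memv0 => /eqP.
Qed.

End Cartan.

(** * Consequences of a nondegenerate Killing form *)

Section NondegenerateKilling.
Variables (F : numFieldType) (k : finLieAlgType F).
Implicit Types (x y z u : k) (xi : dual k).
Hypothesis killing_nondeg : forall x, (forall y, killing x y = 0) -> x = 0.

Local Notation mx := (mxof (vbasis {:k}) (vbasis {:k})).

Lemma killing0l z : killing 0 z = 0.
Proof. by rewrite -killing_mapE hom_simp lfun_simp. Qed.

Lemma killingDl x y z : killing (x + y) z = killing x z + killing y z.
Proof. by rewrite -!killing_mapE hom_simp lfun_simp. Qed.

Lemma killingNl x z : killing (- x) z = - killing x z.
Proof. by rewrite -!killing_mapE hom_simp lfun_simp. Qed.

Lemma killingZl a x z : killing (a *: x) z = a * killing x z.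
Proof. by rewrite -!killing_mapE hom_simp lfun_simp. Qed.

Lemma killingDr x y z : killing z (x + y) = killing z x + killing z y.
Proof. by rewrite killingC killingDl ![killing _ z]killingC. Qed.

Lemma killing_inj x y : (forall z, killing x z = killing y z) -> x = y.
Proof.
move=> e; apply/eqP; rewrite -subr_eq0; apply/eqP/killing_nondeg => z.
by rewrite killingDl killingNl e subrr.
Qed.

Lemma limg_killing_map : limg (@killing_map F k) = fullv.
Proof.
apply/eqP; rewrite eqEdim subvf /= limg_dim_eq.
  by rewrite !dimvf /dim /= muln1.
apply/eqP; rewrite -subv0; apply/subvP=> x; rewrite memv_cap => /andP[_].
by move/mem_killing_radical=> x0; rewrite memv0; apply/eqP/killing_nondeg.
Qed.

Definition killing_sharp : 'Hom(dual k, k) := (killing_map^-1)%VF.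

Lemma killing_sharpE xi y : killing (killing_sharp xi) y = xi y.
Proof. by rewrite -killing_mapE limg_lfunVK // limg_killing_map memvf. Qed.

Lemma ad_eq0 u : (forall x, lie u x = 0) -> u = 0.
Proof.
move=> u0; apply: killing_nondeg => y.
rewrite killingE.
have -> : ad u = 0 by apply/lfunP=> x; rewrite adE u0 lfunE.
by rewrite linear0 mulmx0 mxtrace0.
Qed.

(** This is [[k, k] = k] in dual form: by invariance the vector representing [xi] is central, hence
    zero. *)
Lemma lie_annihilator_eq0 xi : (forall x y, xi (lie x y) = 0) -> xi = 0.
Proof.
move=> xi0; suff u0 : killing_sharp xi = 0.
  by apply/lfunP=> y; rewrite -killing_sharpE u0 killing0l lfunE.
apply: ad_eq0 => x; apply: killing_nondeg => y.
by rewrite killing_inv killing_sharpE.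
Qed.

(** Let [u] represent the form sending [y] to the trace of [ad y] against [D]. Then [E = D - ad u]
    is a derivation trace-orthogonal to every [ad y], and [K(E x, y)] is the trace of [E] against
    [ad [x, y]], hence zero. *)
Lemma derivation_inner (D : 'End(k)) :
  (forall x y, D (lie x y) = lie (D x) y + lie x (D y)) ->
  exists u, forall x, D x = lie u x.
Proof.
have trB (A B : 'M[F]_(\dim {:k})) : \tr (A - B) = \tr A - \tr B.
  by rewrite linearB.
have mxB (f h : 'End(k)) : mx (f - h) = mx f - mx h by rewrite linearB.
have mxM (f h : 'End(k)) : mx (f \o h)%VF = mx h *m mx f.
  by rewrite (mxof_comp _ _ (vbasisP fullv)).
move=> derD.
pose xi : dual k := linfun (fun y => \tr (mx (ad y) *m mx D) : F^o).
have xiE y : xi y = \tr (mx (ad y) *m mx D).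
  rewrite /xi linfun_lin // => a u v.
  by rewrite adD adZ linearP mulmxDl -scalemxAl mxtraceD mxtraceZ.
exists (killing_sharp xi); set u := killing_sharp xi.
have [E EE mxE] : exists2 E : 'End(k), forall x, E x = D x - lie u x
    & mx E = mx D - mx (ad u).
  by exists (D - ad u); rewrite ?mxB // => x; rewrite !lfun_simp adE.
have trE y : \tr (mx (ad y) *m mx E) = 0.
  by rewrite mxE mulmxBr trB -xiE -killing_sharpE -/u killingE subrr.
have adDE x : ad (E x) = (E \o ad x)%VF - (ad x \o E)%VF.
  apply/lfunP=> y; rewrite !(lfun_simp, comp_lfunE, adE) !EE derD.
  by rewrite lieDl lieNl lieDr lieNr [lie u (lie x y)]lie_leibniz; zmod.
suff E0 x : E x = 0.
  by move=> x; apply/eqP; rewrite -subr_eq0 -EE E0.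
apply: killing_nondeg => y.
rewrite killingE adDE mxB !mxM -(trE (lie x y)) ad_lie mxB !mxM.
by rewrite mulmxBr mulmxBl !trB !mulmxA [X in _ - X]mxtrace_mulC !mulmxA.
Qed.

(* By nondegeneracy [l x y = K (D x, y)]; the cocycle identity then says that
   [D - c] is a derivation, hence inner, and both [l] and inner derivations are
   skew, so that [c] times the Killing form vanishes. *)
Lemma cocycle_coboundary (l : 'Hom(k, 'Hom(k, F^o))) (c : F) :
    (0 < \dim {:k})%N -> (forall x, l x x = 0) ->
    (forall x y z, c * killing (lie x y) z =
       l x (lie y z) + l y (lie z x) + l z (lie x y)) ->
  c = 0 /\ exists u, forall x y, l x y = killing u (lie x y).
Proof.
move=> k_gt0 lxx lc.
have lC x y : l x y = - l y x.
  have := lxx (x + y); rewrite !(hom_simp, lfun_simp) !lxx add0r addr0.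
  by move/eqP; rewrite addrC addr_eq0 => /eqP.
have [D DE] : exists D : 'End(k), forall x y, killing (D x) y = l x y.
  by exists (killing_sharp \o l)%VF => x y; rewrite comp_lfunE killing_sharpE.
have derD x y : D (lie x y) = lie (D x) y + lie x (D y) - c *: lie x y.
  apply: killing_inj => z; rewrite !(killingDl, killingNl, killingZl) lc.
  rewrite !DE lC [lie x (D y)]lieC killingNl !killing_inv !DE.
  by rewrite [lie x z]lieC hom_simp; ring.
have [|u uE] := @derivation_inner (D - c *: \1%VF).
  move=> x y; rewrite !(lfun_simp, id_lfunE) derD.
  rewrite lieDl lieDr lieNl lieNr lieZl lieZr /=.
  by rewrite [RHS]addrACA [RHS]addrA.
have Du x : D x = lie u x + c *: x.
  by rewrite -uE !(lfun_simp, id_lfunE) /= subrK.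
have c0 : c = 0.
  (* A nonzero [c] forces [K(x, x) = 0] for all [x]; polarizing and dividing by 2 gives [K = 0],
     hence [k = 0]. *)
  apply/eqP; apply: contraTT k_gt0 => c0; rewrite -eqn0Ngt dimv_eq0.
  have Kxx x : killing x x = 0.
    have := DE x x; rewrite lxx Du killingDl killingZl killing_inv liexx.
    rewrite killingC killing0l add0r => /eqP.
    by rewrite mulf_eq0 (negPf c0) => /eqP.
  rewrite -subv0; apply/subvP=> x _; rewrite memv0; apply/eqP.
  apply: killing_nondeg => y; have := Kxx (x + y).
  rewrite killingDl ![killing _ (x + y)]killingC !killingDl !Kxx add0r addr0.
  by rewrite [killing y x]killingC -mulr2n => /eqP; rewrite mulrn_eq0 => /eqP.
split=> //; exists u => x y.
by rewrite -DE Du c0 scale0r addr0 killing_inv.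
Qed.

End NondegenerateKilling.

(** Lets the isomorphism be built from the semidirect product, where the map is explicit. *)
Lemma lie_isomorphic_inverse (F : fieldType) (L M : lieAlgType F)
    (g : {linear M -> L}) :
    injective g -> (forall y, exists x, g x = y) ->
    {morph g : x y / lie x y} -> lie_isomorphic L M.
Proof.
move=> inj_g surj_g morph_g; have [f gK] := choice surj_g.
have fK : cancel g f by move=> x; apply: inj_g; rewrite gK.
have lin_f : linear f by move=> a x y; apply: inj_g; rewrite linearP !gK.
pose f' : {linear L -> M} := HB.pack f (GRing.isLinear.Build _ _ _ _ f lin_f).
exists f'; first by exists g.
by move=> x y; apply: inj_g; rewrite morph_g /= !gK.
Qed.

(** * Derivations of the string Lie 2-algebra *)

Section StringDerivations.
Variables (F : numFieldType) (k : finLieAlgType F).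
Implicit Types (x y z u : k) (xi : dual k).

(** The cocycle [K([x, y], z)] is invariant under [ad u]: the sum is [K(u, -)] applied to the Jacobi
    identity. *)
Lemma killing_lie_cyclic u x y z :
  killing (lie (lie u x) y) z + killing (lie (lie u y) z) x
  + killing (lie (lie u z) x) y = 0.
Proof. by rewrite !killing_inv -!killingDr lie_jacobi killingC killing0l. Qed.

Local Notation g := (string_lie2 k).

Definition string_der_triple (p : coad_sdprod k) : der_triple g :=
  (ad p.1, 0, ceD p.2).

Lemma string_der_tripleP p : is_der0 (string_der_triple p).
Proof.
case: p => u xi; split=> /=.
- by apply/lfunP=> a; rewrite !comp_lfunE !lfun_simp linear0.
- by move=> x; rewrite ceDE liexx linear0 oppr0.
- move=> x y; rewrite string_dE !string_brE !adE.
  by rewrite lie_leibniz; zmod.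
- by move=> x a; rewrite string_dE linear0 !string_actE lfunE !subr0.
- move=> x y z; rewrite lfunE !string_actE !string_l3E !string_brE !adE !addr0.
  (* The [ceD] terms sum to minus [xi] of the Jacobi identity, and the [l3] terms cancel by
     invariance. *)
  have := killing_lie_cyclic u x y z.
  rewrite !ceDE.
  set a := killing _ _; set b := killing _ _; set c := killing _ _ => abc.
  have := congr1 xi (lie_jacobi x y z); rewrite !hom_simp => Jxi.
  by rewrite (addrACA _ a) [RHS]addrACA abc -!opprD Jxi oppr0 addr0.
Qed.

Definition string_der (p : coad_sdprod k) : der0 g :=
  der0_of (string_der_tripleP p).

Lemma string_der_linear : linear string_der.
Proof.
move=> a p q; apply: val_inj; apply: der_triple_eq => /=.
- by rewrite adD adZ.
- by rewrite scaler0 addr0.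
- apply/lfunP=> x; apply/lfunP=> y; rewrite !(lfun_simp, ceDE).
  by rewrite opprD scalerN.
Qed.

Lemma string_der_lie p q :
  string_der (lie p q) = lie (string_der p) (string_der q).
Proof.
apply: val_inj; apply: der_triple_eq => /=.
- exact: ad_lie.
- by rewrite comp_lfun0r subrr.
- apply/lfunP=> x; apply/lfunP=> y; rewrite !(lfun_simp, lie_derE) /=.
  rewrite !(lfun_simp, ceDE, coadE, adE).
  rewrite ![lie _ (lie x y)]lie_leibniz !hom_simp.
  rewrite !(@lie_derE _ g) /= !(ceDE, adE, lfunE) /= !sub0r !opprK.
  by rewrite [LHS]opprD opprK.
Qed.

Hypothesis killing_nondeg : forall x, (forall y, killing x y = 0) -> x = 0.

Lemma string_der_inj : injective string_der.
Proof.
suff ker p : string_der p = 0 -> p = 0.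
  move=> p q e; apply/eqP; rewrite -subr_eq0; apply/eqP/ker.
  have := string_der_linear (-1) q p; rewrite !scaleN1r => e'.
  by rewrite addrC e' e addNr.
case: p => u xi e.
have /(congr1 (fun X : der_triple g => X.1.1)) /= adu := congr1 val e.
have /(congr1 (fun X : der_triple g => X.2)) /= Dxi := congr1 val e.
have -> : u = 0.
  by apply: (ad_eq0 killing_nondeg) => x; rewrite -adE adu lfunE.
suff -> : xi = 0 by [].
apply: (lie_annihilator_eq0 killing_nondeg) => x y.
by apply: oppr_inj; rewrite -ceDE Dxi !lfun_simp oppr0.
Qed.

Lemma string_der_surj (X : der0 g) :
  (0 < \dim {:k})%N -> exists p, string_der p = X.
Proof.
move=> k_gt0; have XP := der0P X; case: X XP => -[[X0 X1] l] ? XP /=.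
have derX0 x y : X0 (lie x y) = lie (X0 x) y + lie x (X0 y).
  have := der0_br XP x y; rewrite /= string_dE !string_brE.
  move/eqP; rewrite eq_sym subr_eq0 subr_eq => /eqP->; exact: addrC.
have [u uE] := derivation_inner killing_nondeg derX0.
(* The scalar [X1 1] is the constant [c] of [cocycle_coboundary]. *)
have X1E (a : F^o) : X1 a = X1 1 * a.
  by rewrite -[a in LHS]mulr1 [LHS](linearZ_LR X1) /= mulrC.
have lxx x : l x x = 0 by apply: der0_alt XP x.
have lc x y z : X1 1 * killing (lie x y) z =
    l x (lie y z) + l y (lie z x) + l z (lie x y).
  have := der0_l3 XP x y z.
  rewrite /= !string_l3E !string_brE !string_actE !uE X1E => ->.
  have := killing_lie_cyclic u x y z.
  set a := killing _ _; set b := killing _ _; set c := killing _ _ => abc.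
  by rewrite !addr0 (addrACA _ a) [LHS]addrACA abc addr0.
have [X10 [v vE]] := cocycle_coboundary killing_nondeg k_gt0 lxx lc.
(* The sign offsets the one in [ceD]. *)
exists (u, - killing_map v); apply: val_inj; apply: der_triple_eq => /=.
- by apply/lfunP=> x; rewrite adE uE.
- by apply/lfunP=> a; rewrite X1E X10 mul0r lfunE.
- apply/lfunP=> x; apply/lfunP=> y.
  by rewrite ceDE vE lfun_simp killing_mapE opprK.
Qed.

HB.instance Definition _ := GRing.isLinear.Build F _ _ _ string_der
  string_der_linear.

Lemma der0_string_isomorphic :
  (0 < \dim {:k})%N -> lie_isomorphic (der0 g) (coad_sdprod k).
Proof.
move=> k_gt0.
apply: (lie_isomorphic_inverse (g := string_der) string_der_inj) => [X|p q].
  exact: string_der_surj.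
exact: string_der_lie.
Qed.

End StringDerivations.

(** Positive dimension excludes [k = 0], which satisfies [semisimple]: there [X1] is arbitrary, so
    the degree-0 derivations form a line while the semidirect product is zero. *)
Theorem proposition3p4 (R : realType) (k : finLieAlgType R)
    (k_semisimple : semisimple k) :
  [/\ (0 < \dim {:k})%N ->
        lie_isomorphic (der0 (string_lie2 k)) (coad_sdprod k),
      der1 (string_lie2 k) = dual k :> vectType R,
      lie_abelian (der1 (string_lie2 k)) &
      forall T : dual k,
        der0_val (der_dbar (string_lie2 k) T) = (0, 0, - ceD T)].
Proof.
split=> [|//|T T'|T].
- by apply: der0_string_isomorphic => x; apply: killing_eq0.
- rewrite /lie /= /der1_bracket /= /string_d.
  by rewrite !(comp_lfun0r, comp_lfun0l) subrr.
- apply: der_triple_eq => /=.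
  + exact: comp_lfun0l.
  + exact: comp_lfun0r.
  apply/lfunP=> x; apply/lfunP=> y; rewrite (@der_deltaE _ (string_lie2 k)) /=.
  by rewrite !string_actE string_brE subr0 addr0 !lfun_simp ceDE opprK.
Qed.
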